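(* Let $\mathfrak{g}$ be a seven-dimensional real Lie algebra with a codimension one nilpotent ideal $\mathfrak{u}\cong\mathfrak{h}_3\oplus\mathbb{R}^3$, where $\mathfrak{h}_3$ is the three-dimensional Heisenberg algebra. Let $\varphi\in\Lambda^3\mathfrak{g}^*$ be a $\mathrm{G}_2$-structure and fix $X\perp\mathfrak{u}$ with $\|X\|=1$. Write $h=\operatorname{ad}(X)|_{\mathfrak{u}}$ (a derivation of $\mathfrak{u}$) and $(g,J,\sigma,\rho)$ for the special almost Hermitian structure on $\mathfrak{u}$ induced by $\varphi$. Set $$U_1=[\mathfrak{u},\mathfrak{u}]\oplus J[\mathfrak{u},\mathfrak{u}],\qquad U_2=U_1^{\perp}\cap\mathfrak{z}(\mathfrak{u}),$$ where $\mathfrak{z}(\mathfrak{u})$ is the centre of $\mathfrak{u}$ and $\perp$ is taken in $\mathfrak{u}$. Then $\varphi$ is calibrated, i.e. $d\varphi=0$, if and only if $J[\mathfrak{u},\mathfrak{u}]\subset\mathfrak{z}(\mathfrak{u})$ and either (i) $\mathfrak{z}(\mathfrak{u})$ is $J$-invariant and there are $\lambda,\mu\in\mathbb{R}$ and linear maps $h_{ij}\colon U_j\to U_i$ with $[h_{ij},J]=0$ such that $$h=\begin{pmatrix}-2\lambda & h_{12} & h_{13}\\ 0 & 3\lambda+\mu J & h_{23}+\hat h\\ 0&0&-\lambda-\mu J\end{pmatrix}$$ on $\mathfrak{u}=U_1\oplus U_2\oplus U_3$, where $U_3=\mathfrak{z}(\mathfrak{u})^{\perp}$ and $\hat h\colon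 U_3\to U_2$ is given by $$\hat h(Z)=-\frac{\|[Z,JZ]\|^2}{2\,\|\rho([Z,JZ],Z,\cdot)\|^2}\,\rho([Z,JZ],Z,\cdot)^{\sharp}\quad\text{for all }Z\in U_3$$ (with $\hat h(0)=0$); or (ii) $\mathfrak{z}(\mathfrak{u})$ is not $J$-invariant, $\rho$ is zero on $[\mathfrak{u},\mathfrak{u}]\wedge\Lambda^2\mathfrak{z}(\mathfrak{u})$, and there is an $h_1\in\mathfrak{sl}(\mathfrak{u},\rho)$ with $U_1\subset\ker h_1$ and $h_1(\mathfrak{z}(\mathfrak{u}))\subset\mathfrak{z}(\mathfrak{u})$ such that $$h=\operatorname{diag}(-2\lambda,-6\lambda,3\lambda,-\lambda)+h_1$$ on $\mathfrak{u}=[\mathfrak{u},\mathfrak{u}]\oplus J[\mathfrak{u},\mathfrak{u}]\oplus U_2\oplus JU_2$, with $\lambda\in\mathbb{R}$ specified by $-8\lambda\,\rho(Z_1,Z_2,\cdot)^{\sharp}=J[JZ_1,JZ_2]$ for any basis $Z_1,Z_2$ of $U_2$.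
   Context: $d$ is the Chevalley--Eilenberg differential of $\mathfrak{g}$ and the metric on $\mathfrak{g}$ (and, by restriction, $g$ on $\mathfrak{u}$) is the one induced by the $\mathrm{G}_2$-structure $\varphi$. Let $\alpha\in\mathfrak{g}^*$ be the element with $\alpha(\mathfrak{u})=0$, $\alpha(X)=1$. The induced special almost Hermitian ($\mathrm{SU}(3)$-) structure $(\sigma,\rho)\in\Lambda^2\mathfrak{u}^*\times\Lambda^3\mathfrak{u}^*$ is determined by $\varphi=\sigma\wedge\alpha+\rho$; $\sigma$, the almost complex structure $J$ and the metric $g$ are related by $\sigma=g(\cdot,J\cdot)$. Concretely, in a suitable orthonormal basis of $\mathfrak{u}$, $\sigma=e^{12}+e^{34}+e^{56}$, $\rho=e^{135}-e^{146}-e^{236}-e^{245}$, $Je_{2i}=e_{2i-1}$, $Je_{2i-1}=-e_{2i}$ (where $e^{ij}=e^i\wedge e^j$, etc.). $\mathfrak{sl}(\mathfrak{u},\rho)=\{A\in\operatorname{End}(\mathfrak{u})\mid A.\rho=0\}$ with $(A.\rho)(Y_1,Y_2,Y_3)=-\rho(AY_1,Y_2,Y_3)-\rho(Y_1,AY_2,Y_3)-\rho(Y_1,Y_2,AY_3)$. $\sharp\colon\mathfrak{u}^*\to\mathfrak{u}$ is the metric isomorphism. Real numbers in block matrices and in $\operatorname{diag}$ stand for multiples of the identity on the corresponding summands. *)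

(* Defs.v *)
From HB Require Import structures.
From mathcomp Require Import all_boot all_order all_algebra.
From mathcomp Require Import reals.

Set Implicit Arguments.
Unset Strict Implicit.
Unset Printing Implicit Defensive.

Import GRing.Theory Num.Theory.
Local Open Scope ring_scope.

Section LieAlgebra.
Variables (R : realType) (V : vectType R).

Definition is_lie_bracket (br : V -> V -> V) : Prop :=
  (forall x, br x x = 0) /\
  (forall x y z, br x (br y z) + br y (br z x) + br z (br x y) = 0).

Definition lie_prod (br : V -> V -> V) (A B : {vspace V}) : {vspace V} :=
  <<[seq br a b | a <- vbasis A, b <- vbasis B]>>%VS.

Definition lie_derived (br : V -> V -> V) : {vspace V} :=
  lie_prod br fullv fullv.

Definition lie_center (br : {bilinear V -> V -> V}) : {vspace V} :=
  (\bigcap_(i < \dim {:V}) lker (linfun (br (vbasis {:V})`_i)))%VS.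

Definition is_ideal (br : V -> V -> V) (A : {vspace V}) : Prop :=
  (lie_prod br fullv A <= A)%VS.

Definition is_nilpotent (br : V -> V -> V) : Prop :=
  exists n, iter n (lie_prod br fullv) fullv = 0%VS.

Lemma mem_lie_prod (br : V -> V -> V) (A B : {vspace V}) a b :
  a \in vbasis A -> b \in vbasis B -> br a b \in lie_prod br A B.
Proof.
by move=> aA bB; apply/memv_span/allpairsP; exists (a, b).
Qed.

Lemma memv_lie_prod (br : {bilinear V -> V -> V}) (A B : {vspace V}) a b :
  a \in A -> b \in B -> br a b \in lie_prod br A B.
Proof.
move=> /coord_vbasis-> /coord_vbasis->.
rewrite linear_sumlz memv_suml// => i _; rewrite linear_sumr memv_suml// => j _.
rewrite linearZl_LR linearZr_LR/= !memvZ//.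
by apply: mem_lie_prod; rewrite mem_nth// size_tuple.
Qed.

Lemma lie_prod_subP (br : {bilinear V -> V -> V}) (A B C : {vspace V}) :
  (forall a b, a \in A -> b \in B -> br a b \in C) <-> (lie_prod br A B <= C)%VS.
Proof.
split=> [H|/subvP sC a b aA bB]; last exact/sC/memv_lie_prod.
by apply/span_subvP => _ /allpairsP[[a b] [/= /vbasis_mem aA /vbasis_mem bB ->]]; apply: H.
Qed.

Lemma lie_centerP (br : {bilinear V -> V -> V}) z :
  z \in lie_center br <-> forall x, br x z = 0.
Proof.
split=> [/subv_bigcapP H x|H].
  rewrite (coord_vbasis (memvf x)) linear_sumlz big1// => i _.
  have := H i isT; rewrite -memvE memv_ker lfunE/= => /eqP bz.
  by rewrite linearZl_LR bz scaler0.
apply/subv_bigcapP => i _; rewrite -memvE memv_ker lfunE/=.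
by rewrite H.
Qed.

End LieAlgebra.

Definition lie_isomorphic (R : realType) (V W : vectType R)
    (brV : V -> V -> V) (brW : W -> W -> W) : Prop :=
  exists2 f : 'Hom(V, W), bijective f & forall x y, f (brV x y) = brW (f x) (f y).

(* The Heisenberg algebra h_3 on R^3: [e_0, e_1] = e_2, with e_2 central. *)
Definition heis_br (R : realType) (x y : 'rV[R]_3) : 'rV[R]_3 :=
  (x 0 0 * y 0 1 - x 0 1 * y 0 0) *: 'e_(2%:R : 'I_3).

Definition heis_R3_br (R : realType) (x y : ('rV[R]_3 * 'rV[R]_3)%type) :
    ('rV[R]_3 * 'rV[R]_3)%type :=
  (heis_br x.1 y.1, 0).

Section Restriction.
Variables (R : realType) (V : vectType R) (u : {vspace V}).

(* When [u] is stable under the bracket, [vsproj u] only casts here. *)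
Definition restr_br (br : {bilinear V -> V -> V}) (x y : subvs_of u) : subvs_of u :=
  vsproj u (br (vsval x) (vsval y)).

Fact restr_br_bilinear (br : {bilinear V -> V -> V}) :
  bilinear_for *:%R *:%R (restr_br br).
Proof.
by split=> z a x y; rewrite /restr_br linearP ?linearPl ?linearPr/= linearP.
Qed.

HB.instance Definition _ (br : {bilinear V -> V -> V}) :=
  bilinear_isBilinear.Build R (subvs_of u) (subvs_of u) (subvs_of u) _ _
    (restr_br br) (restr_br_bilinear br).

Definition restr_ad (br : {bilinear V -> V -> V}) (X : V) : 'End(subvs_of u) :=
  linfun (fun y => vsproj u (br X (vsval y))).

Lemma restr_adE (br : {bilinear V -> V -> V}) (X : V) y :
  restr_ad br X y = vsproj u (br X (vsval y)).
Proof.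
pose f (y : subvs_of u) : subvs_of u := vsproj u (br X (vsval y)).
have lin : linear f by move=> a x z; rewrite /f !linearP.
pose fL : {linear subvs_of u -> subvs_of u} :=
  HB.pack f (GRing.isLinear.Build _ _ _ _ f lin).
by rewrite /restr_ad -[X in linfun X]/(fL : _ -> _) lfunE.
Qed.

Definition restr_dot (gm : {dot V for idfun}) (x y : subvs_of u) : R :=
  gm (vsval x) (vsval y).

Section RestrictDot.
Variable gm : {dot V for idfun}.

Fact restr_dot_bilinear : bilinear_for *%R (idfun \; *%R) (restr_dot gm).
Proof.
by split=> z a x y; rewrite /restr_dot linearP ?linearPl ?linearPr.
Qed.

Fact restr_dot_sym (x y : subvs_of u) :
  restr_dot gm x y = (-1) ^+ false * idfun (restr_dot gm y x).
Proof. exact: hermC. Qed.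

Fact restr_dot_gt0 (x : subvs_of u) : x != 0 -> 0 < restr_dot gm x x.
Proof.
move=> x0; apply: neq0_dnorm_gt0; apply: contra_neq x0 => vx0.
by apply: val_inj; rewrite /= vx0.
Qed.

HB.instance Definition _ := bilinear_isBilinear.Build R
  (subvs_of u) (subvs_of u) R *%R (idfun \; *%R) (restr_dot gm)
  restr_dot_bilinear.
HB.instance Definition _ := isHermitianSesquilinear.Build R (subvs_of u)
  false idfun (restr_dot gm) restr_dot_sym.
HB.instance Definition _ := isDotProduct.Build R (subvs_of u)
  (restr_dot gm) restr_dot_gt0.

End RestrictDot.

End Restriction.
Arguments restr_br {R V} u br x y.
Arguments restr_ad {R V} u br X.
Arguments restr_dot {R V} u gm x y.

Section Forms.
Variables (R : realType) (V : vectType R).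

Record form2 := Form2 {
  form2_fun :> {biscalar V};
  form2_alt : forall x, form2_fun x x = 0
}.

Record form3 := Form3 {
  form3_fun :> V -> V -> V -> R;
  form3_linear1 : forall y z, scalar (fun x => form3_fun x y z);
  form3_linear2 : forall x z, scalar (fun y => form3_fun x y z);
  form3_linear3 : forall x y, scalar (form3_fun x y);
  form3_alt12 : forall x y, form3_fun x x y = 0;
  form3_alt23 : forall x y, form3_fun x y y = 0
}.

HB.instance Definition _ (w : form3) (x y : V) :=
  GRing.isLinear.Build R V R *%R (form3_fun w x y) (form3_linear3 w x y).

Lemma form3_linfunE (w : form3) x y z : linfun (w x y : V -> R^o) z = w x y z.
Proof. by rewrite lfunE. Qed.

Definition wedge11 (a b : V -> R) (x y : V) : R := a x * b y - a y * b x.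

Definition wedge21 (s : V -> V -> R) (a : V -> R) (x y z : V) : R :=
  s x y * a z - s x z * a y + s y z * a x.

(* [dual e k] is the element e^k of the basis dual to e, with k = 1, ..., 7. *)
Definition dual (e : 7.-tuple V) (k : nat) : V -> R := coord e (inord k.-1).

(* Chevalley-Eilenberg: the sum over i < j of (-1)^(i+j) w([x_i, x_j], ...), the
   dots being the remaining two vectors in order. *)
Definition ce_d3 (br : V -> V -> V) (w : V -> V -> V -> R) (x0 x1 x2 x3 : V) : R :=
  - w (br x0 x1) x2 x3 + w (br x0 x2) x1 x3 - w (br x0 x3) x1 x2
  - w (br x1 x2) x0 x3 + w (br x1 x3) x0 x2 - w (br x2 x3) x0 x1.

Definition is_closed3 (br : V -> V -> V) (w : V -> V -> V -> R) : Prop :=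
  forall x0 x1 x2 x3, ce_d3 br w x0 x1 x2 x3 = 0.

Definition adapted_basis (w : V -> V -> V -> R) (e : 7.-tuple V) : Prop :=
  let sigma0 x y := wedge11 (dual e 1) (dual e 2) x y
    + wedge11 (dual e 3) (dual e 4) x y + wedge11 (dual e 5) (dual e 6) x y in
  let e3 i j k := wedge21 (wedge11 (dual e i) (dual e j)) (dual e k) in
  basis_of fullv e /\
  forall x y z, w x y z = wedge21 sigma0 (dual e 7) x y z
    + e3 1 3 5 x y z - e3 1 4 6 x y z - e3 2 3 6 x y z - e3 2 4 5 x y z.

Definition is_G2_structure (w : V -> V -> V -> R) : Prop :=
  exists e, adapted_basis w e.

(* Any two adapted bases differ by an element of G_2, a subgroup of SO(7), so
   at most one inner product satisfies this. *)
Definition is_G2_metric (w : V -> V -> V -> R) (gm : {dot V for idfun}) : Prop :=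
  exists2 e : 7.-tuple V, adapted_basis w e & orthonormal gm e.

Definition act3 (A : 'End(V)) (w : V -> V -> V -> R) (x y z : V) : R :=
  - w (A x) y z - w x (A y) z - w x y (A z).

Definition in_sl (w : V -> V -> V -> R) (A : 'End(V)) : Prop :=
  forall x y z, act3 A w x y z = 0.

Section Musical.
Variable gm : {dot V for idfun}.

Definition flat : 'Hom(V, 'Hom(V, R^o)) :=
  linfun (fun v => linfun (gm v : V -> R^o)).

Definition sharp : 'Hom('Hom(V, R^o), V) := (flat^-1)%VF.

Lemma flatE v x : flat v x = gm v x.
Proof.
pose f v : 'Hom(V, R^o) := linfun (gm v : V -> R^o).
have lin : linear f.
  by move=> a y z; apply/lfunP => t; rewrite add_lfunE scale_lfunE !lfunE/= linearPl.
pose fL : {linear V -> 'Hom(V, R^o)} :=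
  HB.pack f (GRing.isLinear.Build _ _ _ _ f lin).
by rewrite /flat -[X in linfun X]/(fL : V -> _) lfunE/= lfunE.
Qed.

Lemma sharpE (a : 'Hom(V, R^o)) x : gm (sharp a) x = a x.
Proof.
have ker0 : lker flat = 0%VS.
  apply/eqP; rewrite -subv0; apply/subvP => v; rewrite memv_ker memv0.
  move=> /eqP fv; apply/negPn/negP => /(@neq0_dnorm_gt0 _ _ _ gm).
  by rewrite -flatE fv lfunE/= Order.POrderTheory.ltxx.
have surj : limg flat = fullv.
  apply/eqP; rewrite eqEdim subvf/=.
  rewrite limg_dim_eq ?ker0 ?capv0//.
  by rewrite !dimvf /= /dim/= muln1.
by rewrite -flatE limg_lfunVK// surj memvf.
Qed.

End Musical.
End Forms.

Section SU3.
Variables (R : realType) (g : vectType R) (u : {vspace g}).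

(* phi = sigma /\ alpha + rho, where forms on [u] are extended to [g] by the
   projection [pr] along [X]. *)
Definition is_induced_SU3 (gm : {dot g for idfun}) (phi : form3 g) (X : g)
    (sigma : form2 (subvs_of u)) (rho : form3 (subvs_of u))
    (J : 'End(subvs_of u)) : Prop :=
  exists alpha : {scalar g},
    let pr x : subvs_of u := vsproj u (x - alpha x *: X) in
    [/\ {in u, forall y, alpha y = 0}, alpha X = 1,
        forall x y z, phi x y z =
          wedge21 (fun x y => sigma (pr x) (pr y)) alpha x y z
          + rho (pr x) (pr y) (pr z)
      & forall y z, sigma y z = restr_dot u gm y (J z)].

End SU3.

Section Blocks.
Variables (R : realType) (V : vectType R).

Definition is_decomposition (s : seq {vspace V}) : Prop :=
  directv (\sum_(A <- s) A) /\ (\sum_(A <- s) A)%VS = fullv.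

(* A linear map A -> B commuting with [J] is represented by any endomorphism
   extending it; only its values on [A] matter. *)
Definition is_Jlinear_on (J : 'End(V)) (A B : {vspace V}) (f : 'End(V)) : Prop :=
  (f @: A <= B)%VS /\ {in A, forall x, f (J x) = J (f x)}.

Definition hat_map (br : V -> V -> V) (gm : {dot V for idfun}) (rho : form3 V)
    (J : 'End(V)) (z : V) : V :=
  if z == 0 then 0 else
  let w := br z (J z) in
  let eta := linfun (rho w z : V -> R^o) in
  - (gm w w / (2 * gm (sharp gm eta) (sharp gm eta))) *: sharp gm eta.

End Blocks.

(* Main.v *)
Require Import Defs.
From HB Require Import structures.
From mathcomp Require Import all_boot all_order all_algebra.
From mathcomp Require Import reals ring lra zify.

Set Implicit Arguments.
Unset Strict Implicit.
Unset Printing Implicit Defensive.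

Import GRing.Theory Num.Theory.
Local Open Scope ring_scope.

(** Brackets of [g] lie in the ideal [u], so splitting off the direction of
    [X] turns the closedness of [phi = sigma /\ alpha + rho] into two conditions
    on [u] ([closed_phi_iff]): [rho] is closed on [u], and [h . rho = d sigma]
    ([structure_eq]).

    The bracket of [u] is [omega x y *: xi], where [xi] is a unit vector and
    [omega] is the wedge of two one-forms, with the centre as its kernel.  Thus
    [rho] is closed iff [rho (xi, _, _)] vanishes on the centre
    ([heis_closed3]).  As that two-form has kernel spanned by [xi] and [J xi] in
    dimension six and the centre has dimension four, [J xi] is then central
    ([center_Jxi]).

    The second condition is affine in [h]: once it holds for one endomorphism
    [A], it holds for [h] iff [h - A] is in the stabiliser algebra of [rho]
    ([structure_eq_sl]).  Elements of that algebra commute with [J]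
    ([in_sl_comm]) and have complex trace zero.  If the centre is
    [J]-invariant, [A] is the map called [hat_map], extended by zero to the
    centre ([jinv_structure_A], [jinv_hat]); otherwise [A] is diagonal
    ([treal_structure_A]).  Both are checked in a complex basis adapted to the
    centre, in which [rho] is a combination of the real and imaginary parts of
    the complex determinant ([complex_type_det]).

    Finally [h] is a derivation: it preserves the centre, and it acts on [xi] by
    its trace on the quotient of [u] by the centre ([der_omega]).  Compared with
    the vanishing complex trace of [h - A], this determines all the diagonal
    coefficients of [h] up to the parameters of the statement ([jinv_fwd],
    [treal_fwd]).

    The SU(3)-structure enters through four identities ([su3]), which follow
    from the norm identity of the cross product of a G2-structure
    ([G2_vec]). *)

(** * Alternating three-forms and inner products *)
Section Form3.
Variables (R : realType) (V : vectType R) (w : form3 V).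

Lemma form3D1 x x' y z : w (x + x') y z = w x y z + w x' y z.
Proof. by have := form3_linear1 w y z 1 x x'; rewrite scale1r mul1r. Qed.

Lemma form3D2 x y y' z : w x (y + y') z = w x y z + w x y' z.
Proof. by have := form3_linear2 w x z 1 y y'; rewrite scale1r mul1r. Qed.

Lemma form3D3 x y z z' : w x y (z + z') = w x y z + w x y z'.
Proof. by have := form3_linear3 w x y 1 z z'; rewrite scale1r mul1r. Qed.

Lemma form3C12 x y z : w y x z = - w x y z.
Proof.
have := form3_alt12 w (x + y) z.
rewrite form3D1 !form3D2 !form3_alt12 add0r addr0 => /eqP.
by rewrite addrC addr_eq0 => /eqP.
Qed.

Lemma form3C23 x y z : w x z y = - w x y z.
Proof.
have := form3_alt23 w x (y + z).
rewrite form3D2 !form3D3 !form3_alt23 add0r addr0 => /eqP.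
by rewrite addrC addr_eq0 => /eqP.
Qed.

Lemma form3_rot x y z : w y z x = w x y z.
Proof. by rewrite form3C23 form3C12 opprK. Qed.

Lemma form3_alt13 x y : w x y x = 0.
Proof. by rewrite form3C23 form3_alt12 oppr0. Qed.

Lemma form3Z3 x y a z : w x y (a *: z) = a * w x y z.
Proof.
have z0 : w x y 0 = 0.
  by have := form3D3 x y 0 0; rewrite addr0 => /eqP; rewrite -subr_eq0 opprD addNKr oppr_eq0 => /eqP.
by have := form3_linear3 w x y a z 0; rewrite !addr0 z0 addr0.
Qed.

Lemma form3Z1 a x y z : w (a *: x) y z = a * w x y z.
Proof. by rewrite -form3_rot form3Z3 form3_rot. Qed.

Lemma form3Z2 x a y z : w x (a *: y) z = a * w x y z.
Proof. by rewrite form3C23 form3Z3 form3C23 mulrN opprK. Qed.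

Lemma form3N1 x y z : w (- x) y z = - w x y z.
Proof. by rewrite -scaleN1r form3Z1 mulN1r. Qed.

Lemma form3N2 x y z : w x (- y) z = - w x y z.
Proof. by rewrite -scaleN1r form3Z2 mulN1r. Qed.

Lemma form3N3 x y z : w x y (- z) = - w x y z.
Proof. by rewrite -scaleN1r form3Z3 mulN1r. Qed.

Lemma form301 y z : w 0 y z = 0.
Proof. by rewrite -(scale0r 0) form3Z1 mul0r. Qed.

Lemma form302 x z : w x 0 z = 0.
Proof. by rewrite -(scale0r 0) form3Z2 mul0r. Qed.

Lemma form303 x y : w x y 0 = 0.
Proof. by rewrite -(scale0r 0) form3Z3 mul0r. Qed.

Definition form3E := (form3D1, form3D2, form3D3, form3Z1, form3Z2, form3Z3,
  form3N1, form3N2, form3N3, form301, form302, form303).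
End Form3.

Section Dot.
Variables (R : realType) (V : vectType R) (g : {dot V for idfun}).

Lemma dotC x y : g x y = g y x.
Proof. by rewrite hermC expr0 mul1r. Qed.

Lemma dotDl x x' y : g (x + x') y = g x y + g x' y.
Proof. by rewrite linearDl. Qed.

Lemma dotDr x y y' : g x (y + y') = g x y + g x y'.
Proof. by rewrite linearDr. Qed.

Lemma dotZl a x y : g (a *: x) y = a * g x y.
Proof. by rewrite linearZl_LR. Qed.

Lemma dotZr a x y : g x (a *: y) = a * g x y.
Proof. by rewrite linearZr_LR. Qed.

Lemma dotNl x y : g (- x) y = - g x y.
Proof. by rewrite linearNl. Qed.

Lemma dotNr x y : g x (- y) = - g x y.
Proof. by rewrite linearNr. Qed.

Lemma dot0l y : g 0 y = 0.
Proof. by rewrite linear0l. Qed.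

Lemma dot0r y : g y 0 = 0.
Proof. by rewrite linear0r. Qed.

Lemma dot_suml (I : finType) (f : I -> V) y :
  g (\sum_i f i) y = \sum_i g (f i) y.
Proof. by rewrite linear_sumlz. Qed.

Lemma dot_sumr (I : finType) x (f : I -> V) :
  g x (\sum_i f i) = \sum_i g x (f i).
Proof. by rewrite linear_sumr. Qed.

Definition dotE := (dotDl, dotDr, dotZl, dotZr, dotNl, dotNr, dot0l, dot0r).

Lemma dot_eq0 x : g x x = 0 -> x = 0.
Proof.
move=> gx; apply/eqP/negPn/negP => /(@neq0_dnorm_gt0 _ _ _ g).
by rewrite gx Order.POrderTheory.ltxx.
Qed.

Lemma dot_inj x y : (forall z, g x z = g y z) -> x = y.
Proof.
by move=> h; apply/eqP; rewrite -subr_eq0; apply/eqP/dot_eq0; rewrite dotDl dotNl h subrr.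
Qed.

(** For the three-form of a G2-structure this is the cross product of [x] and
    [y]. *)
Definition vec (w : form3 V) x y : V := sharp g (linfun (w x y : V -> R^o)).

Lemma vecE w x y z : g (vec w x y) z = w x y z.
Proof. by rewrite sharpE lfunE. Qed.
End Dot.

Lemma orthonormal_nth (R : realType) (V : vectType R) (g : {dot V for idfun})
    (s : seq V) i j : orthonormal g s -> (i < size s)%N -> (j < size s)%N ->
  g s`_i s`_j = (i == j)%:R.
Proof.
elim: s i j => // v s IHs i j /andP[/= /andP[/eqP v1 s1] /andP[/andP[/allP vs _] ss]].
case: i j => [|i] [|j] //=; rewrite ?ltnS => li lj.
- exact/eqP/vs/mem_nth.
- by rewrite dotC; apply/eqP/vs/mem_nth.
- by rewrite IHs// /orthonormal s1 ss.
Qed.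

(** * From the G2-structure to the induced SU(3)-structure *)
Section G2.
Variables (R : realType) (V : vectType R) (phi : form3 V) (gm : {dot V for idfun}).

(** The polarised form of |x * y|^2 = |x|^2 |y|^2 - (x, y)^2 for the cross
    product.  In an adapted orthonormal basis it is a polynomial identity in the
    coordinates of [x], [y] and [z]. *)
Lemma G2_vec : is_G2_metric phi gm -> forall x y z,
  gm (vec gm phi x y) (vec gm phi x z) = gm x x * gm y z - gm x y * gm x z.
Proof.
case=> e [eB]; rewrite -[3%R]/3%N -[4%R]/4%N -[5%R]/5%N -[6%R]/6%N -[2%R]/2%N => phiE eon x y z.
have fe := basis_free eB.
have ge (i j : 'I_7) : gm e`_i e`_j = (i == j)%:R.
  by rewrite orthonormal_nth ?size_tuple.
have gE a b : gm a b = \sum_(i < 7) coord e i a * coord e i b.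
  rewrite {1}(coord_basis eB (memvf a)) {1}(coord_basis eB (memvf b)).
  rewrite dot_suml; apply: eq_bigr => i _.
  rewrite dotZl dot_sumr (bigD1 i)//= big1 ?addr0.
    by rewrite dotZr ge eqxx mulr1.
  by move=> j ji; rewrite dotZr ge eq_sym (negPf ji) mulr0.
have gEe a (i : 'I_7) : gm a e`_i = coord e i a.
  rewrite gE (bigD1 i)//= big1 ?addr0.
    by rewrite coord_free ?eqxx ?mulr1.
  by move=> j ji; rewrite coord_free// eq_sym (negPf ji) mulr0.
have dE (k : nat) (i : 'I_7) : (k < 7)%N -> dual e k.+1 e`_i = (k == i)%:R.
  by move=> k7; rewrite /dual coord_free// -val_eqE /= inordK// eq_sym.
have {}gE a b : gm a b = \sum_(i < 7) dual e i.+1 a * dual e i.+1 b.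
  by rewrite gE; apply: eq_bigr => i _; rewrite /dual inord_val.
have {}gEe a (i : 'I_7) : gm a e`_i = dual e i.+1 a.
  by rewrite gEe /dual inord_val.
have sum7 (F : nat -> R) :
    \sum_(i < 7) F i = F 0 + F 1 + F 2 + F 3 + F 4 + F 5 + F 6.
  by rewrite !big_ord_recl big_ord0 addr0 !addrA.
have {}sum7 := (sum7 (fun k => dual e k.+1 _ * dual e k.+1 _)).
have dvec v i : (i < 7)%N -> dual e i.+1 (vec gm phi x v) = phi x v e`_i.
  by move=> i7; rewrite -(gEe _ (Ordinal i7)) vecE.
rewrite !gE !sum7 !dvec// !phiE /wedge21 /wedge11.
have dE' k i : (k < 7)%N -> (i < 7)%N -> dual e k.+1 e`_i = (k == i)%:R.
  by move=> k7 i7; rewrite (dE _ (Ordinal i7)).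
rewrite !dE'//=.
ring.
Qed.
End G2.

Section Scalar.
Variables (R : realType) (W : vectType R) (f : {scalar W}).

Lemma scalarD x y : f (x + y) = f x + f y. Proof. exact: linearD. Qed.

Lemma scalarZ a x : f (a *: x) = a * f x. Proof. exact: linearZ. Qed.
End Scalar.

(** The algebraic identities of an SU(3)-structure on which everything below
    rests.  [su3rhoJ12] says that [rho] is the real part of a complex
    three-form; [su3vec], the restriction of the G2 identity, makes that complex
    form nonzero and fixes its size. *)
Record su3 (R : realType) (W : vectType R) (g : {dot W for idfun})
    (J : 'End(W)) (rho : form3 W) : Prop := SU3 {
  su3JJ : forall x, J (J x) = - x;
  su3gJ : forall x y, g (J x) y = - g x (J y);
  su3rhoJ12 : forall x y z, rho (J x) y z = rho x (J y) z;
  su3vec : forall x y z, g (vec g rho x y) (vec g rho x z) =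
    g x x * g y z - g x y * g x z - g x (J y) * g x (J z)
}.

(** [h . rho = d sigma] on [u], with [sigma x y = g x (J y)]. *)
Definition structure_eq (R : realType) (W : vectType R) (g : {dot W for idfun})
    (J : 'End(W)) (rho : form3 W) (bu : W -> W -> W) (h : 'End(W)) :=
  forall x y z, act3 h rho x y z +
    (g (bu x y) (J z) - g (bu x z) (J y) + g (bu y z) (J x)) = 0.

Section Induced.
Variables (R : realType) (g : vectType R) (u : {vspace g}).
Variables (gm : {dot g for idfun}) (phi : form3 g) (X : g).
Hypotheses (dimu : (\dim u).+1 = \dim {:g}) (Xu : X \in orthov gm u) (X1 : gm X X = 1).

Lemma dotXu y : y \in u -> gm X y = 0.
Proof. by move=> yu; have /mem_orthovP := Xu; apply. Qed.

Lemma hyperplane_add_normal : (u + <[X]>)%VS = fullv.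
Proof.
have X0 : X != 0 by apply: contra_eq_neq X1 => ->; rewrite dot0l eq_sym oner_neq0.
apply/eqP; rewrite eqEdim subvf /= -dimu dimv_disjoint_sum ?dim_vline ?X0 ?addn1//.
apply/eqP; rewrite -subv0; apply/subvP => y; rewrite memv_cap memv0 => /andP[yu /vlineP[a ya]].
have := dotXu yu; rewrite ya dotZr X1 mulr1 => ->; by rewrite scale0r.
Qed.

Lemma hyperplane_proj (alpha : {scalar g}) : {in u, forall y, alpha y = 0} ->
  alpha X = 1 -> forall x, x - alpha x *: X \in u.
Proof.
move=> au aX x; have := memvf x; rewrite -hyperplane_add_normal.
case/memv_addP => y yu [_ /vlineP[a ->] ->].
by rewrite scalarD scalarZ au// aX mulr1 add0r addrK.
Qed.

Variables (sigma : form2 (subvs_of u)) (rho : form3 (subvs_of u)) (J : 'End(subvs_of u)).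
Hypothesis HG2 : is_G2_metric phi gm.
Hypothesis HSU3 : is_induced_SU3 gm phi X sigma rho J.

Local Notation gu := (restr_dot u gm : {dot subvs_of u for idfun}).
Local Notation v := (@vsval R g u).

Lemma induced_sigma y z : sigma y z = gu y (J z).
Proof. by case: HSU3 => alpha [_ _ _ ->]. Qed.

(** The decomposition [phi = sigma /\ alpha + rho] without the projection onto
    [u]: vectors of [g] are written [y + a X] with [y] in [u]. *)
Lemma induced_phi : exists2 alpha : {scalar g},
  forall x, exists y, x = v y + alpha x *: X &
  forall x y z a b c,
    phi (v x + a *: X) (v y + b *: X) (v z + c *: X) =
    gu x (J y) * c - gu x (J z) * b + gu y (J z) * a + rho x y z.
Proof.
case: HSU3 => alpha [au aX phiE sE]; exists alpha => [x|x y z a b c].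
  exists (vsproj u (x - alpha x *: X)).
  by rewrite vsprojK ?subrK//; apply: hyperplane_proj.
have aE t d : alpha (v t + d *: X) = d.
  by rewrite scalarD scalarZ au ?subvsP// aX mulr1 add0r.
rewrite phiE /wedge21 !aE.
have pE t d : vsproj u (v t + d *: X - d *: X) = t by rewrite addrK vsvalK.
by rewrite !pE !sE.
Qed.

Lemma induced_phi_rho x y z : phi (v x) (v y) (v z) = rho x y z.
Proof.
have [alpha _ /(_ x y z 0 0 0)] := induced_phi.
by rewrite !scale0r !addr0 !mulr0 subr0 !add0r.
Qed.

Lemma induced_phi_sigma x y : phi (v x) (v y) X = gu x (J y).
Proof.
have [alpha _ /(_ x y 0 0 0 1)] := induced_phi.
by rewrite !scale0r scale1r !addr0 linear0 add0r mulr1 !mulr0 form303 subr0 !addr0.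
Qed.

Lemma dotX_vsval y : gm X (v y) = 0.
Proof. by rewrite dotXu ?subvsP. Qed.

Lemma hyperplane_dot_inj a b : gm a X = gm b X ->
  (forall y, gm a (v y) = gm b (v y)) -> a = b.
Proof.
move=> abX abu; apply: (dot_inj (g := gm)) => z.
have [alpha /(_ z)[y ->] _] := induced_phi.
by rewrite !dotDr !dotZr abX abu.
Qed.

Lemma induced_vecX z : vec gm phi X (v z) = - v (J z).
Proof.
apply: hyperplane_dot_inj => [|y].
  by rewrite vecE form3_alt13 dotNl dotC dotX_vsval oppr0.
by rewrite vecE dotNl -form3_rot form3C12 induced_phi_sigma dotC.
Qed.

Lemma induced_vec y z : vec gm phi (v y) (v z) = v (vec gu rho y z) + gu y (J z) *: X.
Proof.
apply: hyperplane_dot_inj => [|x].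
  by rewrite vecE induced_phi_sigma dotDl dotZl X1 mulr1 dotC dotX_vsval add0r.
rewrite vecE induced_phi_rho dotDl dotZl dotX_vsval mulr0 addr0.
by rewrite -(vecE gu).
Qed.

Lemma induced_gJ x y : gu (J x) y = - gu x (J y).
Proof.
have := form2_alt sigma (x + y).
rewrite induced_sigma [J (x + y)]linearD !dotE -!induced_sigma !form2_alt add0r addr0.
by rewrite induced_sigma addrC => /eqP; rewrite addr_eq0 [gu (J x) y]dotC induced_sigma => /eqP.
Qed.

(** The complex type of [rho] comes from polarising the G2 identity in its first
    argument, between [X] and [z]: the right-hand side vanishes since [X] is
    orthogonal to [u]. *)
Lemma induced_su3 : su3 gu J rho.
Proof.
have Q := G2_vec HG2.
have JJ x y : gu (J x) (J y) = gu x y.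
  have := Q X (v x) (v y).
  by rewrite !induced_vecX !dotE opprK X1 !dotX_vsval mulr0 subr0 mul1r.
split.
- move=> x; apply: (dot_inj (g := gu)) => y.
  by rewrite induced_gJ JJ dotNl.
- exact: induced_gJ.
- move=> x y z.
  have QX : gm (vec gm phi X (v x)) (vec gm phi (v z) (v y))
    + gm (vec gm phi (v z) (v x)) (vec gm phi X (v y)) = 0.
    have vD a b c : vec gm phi (a + b) c = vec gm phi a c + vec gm phi b c.
      by apply: (dot_inj (g := gm)) => t; rewrite dotDl !vecE form3D1.
    have := Q (X + v z) (v x) (v y).
    rewrite !vD !dotE !Q X1 !dotX_vsval [gm (v z) X]dotC dotX_vsval => /eqP.
    rewrite -subr_eq0 => /eqP <-; ring.
  move: QX; rewrite !induced_vecX !dotE [gm _ (vec _ _ _ _)]dotC !vecE !induced_phi_rho.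
  rewrite -[rho z x _]form3_rot -[rho z y _]form3_rot form3C12 opprK.
  by move/eqP; rewrite subr_eq0 => /eqP.
- move=> x y z; have := Q (v x) (v y) (v z).
  rewrite !induced_vec !dotE dotX_vsval X1 [gm _ X]dotC dotX_vsval.
  rewrite !mulr0 !mulr1 addr0 add0r => Qxyz.
  by apply: (addIr (gu x (J y) * gu x (J z))); rewrite subrK.
Qed.

Section Closed.
Variables (br : {bilinear g -> g -> g}).
Hypotheses (Hbr : is_lie_bracket br) (Hideal : is_ideal br u).

Local Notation bu := (restr_br u br).
Local Notation h := (restr_ad u br X).

Lemma lie_brC x y : br x y = - br y x.
Proof.
case: Hbr => alt _; have := alt (x + y).
rewrite linearDl !linearDr !alt add0r addr0 => /eqP.
by rewrite addr_eq0 => /eqP.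
Qed.

Lemma ideal_br x y : y \in u -> br x y \in u.
Proof. by move=> yu; apply: (proj2 (lie_prod_subP br fullv u u)); rewrite ?memvf. Qed.

Lemma vsval_restr_br x y : v (bu x y) = br (v x) (v y).
Proof. by rewrite vsprojK// ideal_br// subvsP. Qed.

Lemma vsval_restr_ad y : v (h y) = br X (v y).
Proof. by rewrite restr_adE vsprojK// ideal_br// subvsP. Qed.

Lemma restr_ad_derivation x y : h (bu x y) = bu (h x) y + bu x (h y).
Proof.
case: (Hbr) => _ /(_ X (v x) (v y)) jac; apply: val_inj.
change (v (h (bu x y)) = v (bu (h x) y) + v (bu x (h y))).
rewrite !(vsval_restr_ad, vsval_restr_br).
rewrite (lie_brC (v y) X) linearNr /= (lie_brC (v y)) -addrA -opprD in jac.
by apply/eqP; rewrite -subr_eq0 addrC [br (br _ _) _ + _]addrC; apply/eqP; rewrite -[RHS]jac addrC.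
Qed.

Lemma br_hyperplane x y a b :
  br (v x + a *: X) (v y + b *: X) = v (bu x y + (a *: h y - b *: h x)).
Proof.
case: (Hbr) => alt _.
rewrite linearDl !linearDr !linearZl_LR !linearZr_LR /= alt !scaler0 addr0.
rewrite [br (v x) X]lie_brC -vsval_restr_br -!vsval_restr_ad.
by rewrite scalerN -addrA [- _ + _]addrC.
Qed.

(** [d phi] is alternating and [X] spans a complement of [u], so it is
    determined by its values on four vectors of [u], and on [X] and three
    vectors of [u]. *)
Lemma closed_phi_iff : is_closed3 br phi <-> is_closed3 bu rho /\ structure_eq gu J rho bu h.
Proof.
have [alpha dec phiE] := induced_phi.
have cE x0 a0 x1 a1 x2 a2 x3 a3 :
  ce_d3 br phi (v x0 + a0 *: X) (v x1 + a1 *: X) (v x2 + a2 *: X) (v x3 + a3 *: X)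
  = ce_d3 bu rho x0 x1 x2 x3
  + a0 * (act3 h rho x1 x2 x3 + (gu (bu x1 x2) (J x3) - gu (bu x1 x3) (J x2) + gu (bu x2 x3) (J x1)))
  - a1 * (act3 h rho x0 x2 x3 + (gu (bu x0 x2) (J x3) - gu (bu x0 x3) (J x2) + gu (bu x2 x3) (J x0)))
  + a2 * (act3 h rho x0 x1 x3 + (gu (bu x0 x1) (J x3) - gu (bu x0 x3) (J x1) + gu (bu x1 x3) (J x0)))
  - a3 * (act3 h rho x0 x1 x2 + (gu (bu x0 x1) (J x2) - gu (bu x0 x2) (J x1) + gu (bu x1 x2) (J x0))).
  rewrite /ce_d3 !br_hyperplane.
  have pE w a b x y z c d t : phi (v (w + (a *: x - b *: y))) (v z + c *: X) (v t + d *: X)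
    = (gu w (J z) + (a * gu x (J z) - b * gu y (J z))) * d
    - (gu w (J t) + (a * gu x (J t) - b * gu y (J t))) * c
    + (rho w z t + (a * rho x z t - b * rho y z t)).
    rewrite -[v (_ + _)]addr0 -[0](scale0r X) phiE mulr0 addr0.
    by rewrite !dotDl !dotNl !dotZl !form3D1 form3N1 !form3Z1.
  rewrite !pE /act3.
  have r2 x y z : rho x (h y) z = - rho (h y) x z by rewrite form3C12.
  have r3 x y z : rho x y (h z) = rho (h z) x y by rewrite form3_rot.
  by rewrite !r2 !r3; ring.
split.
- move=> cl; split=> [x0 x1 x2 x3|x y z].
    by have := cE x0 0 x1 0 x2 0 x3 0; rewrite cl !mul0r !(subr0, addr0).
  have := cE 0 1 x 0 y 0 z 0; rewrite cl !mul0r mul1r !(subr0, addr0).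
  by rewrite /ce_d3 /restr_br !linear0l !linear0 !form3E !oppr0 !(subr0, addr0, add0r).
- move=> [E1 E2] y0 y1 y2 y3.
  have [x0 ->] := dec y0; have [x1 ->] := dec y1.
  have [x2 ->] := dec y2; have [x3 ->] := dec y3.
  by rewrite cE E1 !E2 !mulr0 !(subr0, addr0).
Qed.
End Closed.
End Induced.

(** * Three-forms of complex type and complex frames *)
Section ComplexType.
Variables (R : realType) (W : vectType R) (J : 'End(W)).
Hypothesis JJ : forall x, J (J x) = - x.

(** Being the real part of a complex trilinear form for [J]. *)
Definition complex_type (T : form3 W) := forall x y z, T (J x) y z = T x (J y) z.

Section TypeTheory.
Variable T : form3 W.
Hypothesis TJ : complex_type T.

Lemma complex_typeJ23 x y z : T x (J y) z = T x y (J z).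
Proof. by rewrite -form3_rot TJ form3_rot. Qed.

Lemma complex_typeJJ x y z : T (J (J x)) y z = - T x y z.
Proof. by rewrite JJ form3N1. Qed.

Lemma complex_type_line x z : T (J x) x z = 0.
Proof. by rewrite TJ complex_typeJ23 form3_alt12. Qed.

Lemma complex_type_line13 x y : T (J x) y x = 0.
Proof. by rewrite form3C23 complex_type_line oppr0. Qed.
End TypeTheory.

Section Frame.
Variables b0 b1 b2 : W.

Definition frame : 6.-tuple W := [tuple b0; J b0; b1; J b1; b2; J b2].

(** The complex coordinates with respect to [b0], [b1], [b2] have real parts
    [co 0], [co 2], [co 4] and imaginary parts [co 1], [co 3], [co 5]. *)
Definition co (k : nat) (x : W) : R := coord frame (inord k) x.

(** Pairing a complex linear relation with [b1] and [b2] under [T], before and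
    after applying [J], gives a linear system for the coefficients of [b0] and
    [J b0] whose determinant is minus the squared modulus of the complex volume. *)
Lemma frame_coef0 (T : form3 W) (a0 c0 a1 c1 a2 c2 : R) : complex_type T ->
  (T b0 b1 b2 != 0) || (T (J b0) b1 b2 != 0) ->
  a0 *: b0 + c0 *: J b0 + (a1 *: b1 + c1 *: J b1) + (a2 *: b2 + c2 *: J b2) = 0 ->
  a0 = 0 /\ c0 = 0.
Proof.
move=> TJ T0 /[dup] x0 /(congr1 J); move: x0; set x := (X in X = 0) => x0.
rewrite linear0 => Jx0.
have e1 : a0 * T b0 b1 b2 + c0 * T (J b0) b1 b2 = 0.
  have : T x b1 b2 = 0 by rewrite x0 form3E.
  rewrite /x !form3E complex_type_line// complex_type_line13//.
  by rewrite form3_alt12 form3_alt13 !mulr0 !addr0.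
have e2 : a0 * T (J b0) b1 b2 - c0 * T b0 b1 b2 = 0.
  have : T (J x) b1 b2 = 0 by rewrite Jx0 form3E.
  rewrite /x !linearD !linearZ /= !JJ !form3E complex_type_line// complex_type_line13//.
  by rewrite form3_alt12 form3_alt13 !(mulr0, oppr0, addr0) mulrN.
set r := T b0 b1 b2 in e1 e2 T0; set s := T (J b0) b1 b2 in e1 e2 T0.
have n0 : r ^+ 2 + s ^+ 2 != 0.
  rewrite paddr_eq0 ?sqr_ge0// !expf_eq0 /= negb_and; exact: T0.
have a00 : a0 * (r ^+ 2 + s ^+ 2) = 0.
  rewrite [LHS](_ : _ = r * (a0 * r + c0 * s) + s * (a0 * s - c0 * r)); last ring.
  by rewrite e1 e2 !mulr0 addr0.
have c00 : c0 * (r ^+ 2 + s ^+ 2) = 0.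
  rewrite [LHS](_ : _ = s * (a0 * r + c0 * s) - r * (a0 * s - c0 * r)); last ring.
  by rewrite e1 e2 !mulr0 subr0.
by split; apply: (mulIf n0); rewrite mul0r.
Qed.
End Frame.

(** A nonzero complex volume makes three vectors a complex basis; cyclic
    symmetry reduces this to the coefficients of the first vector. *)
Lemma frame_basis (T : form3 W) b0 b1 b2 : complex_type T -> \dim {:W} = 6%N ->
  (T b0 b1 b2 != 0) || (T (J b0) b1 b2 != 0) ->
  basis_of fullv (frame b0 b1 b2).
Proof.
move=> TJ dimW T0; rewrite basisEfree subvf dimW size_tuple leqnn !andbT.
have c0 := @frame_coef0 b0 b1 b2 T _ _ _ _ _ _ TJ T0.
have c1 a0 d0 a1 d1 a2 d2 := @frame_coef0 b1 b2 b0 T a0 d0 a1 d1 a2 d2 TJ.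
have c2 a0 d0 a1 d1 a2 d2 := @frame_coef0 b2 b0 b1 T a0 d0 a1 d1 a2 d2 TJ.
rewrite (form3_rot T b0 b1 b2) (form3_rot T b0 (J b1) b2) -TJ T0 in c1.
rewrite -(form3_rot T b2 b0 b1) -(form3_rot T (J b2) b0 b1) -complex_typeJ23// -TJ T0 in c2.
apply/freeP => k; rewrite !big_ord_recl big_ord0 addr0 /=.
set a0 := k _; set d0 := k _; set a1 := k _; set d1 := k _; set a2 := k _; set d2 := k _.
have sumE : a0 *: b0 + (d0 *: J b0 + (a1 *: b1 + (d1 *: J b1 + (a2 *: b2 + d2 *: J b2))))
  = a0 *: b0 + d0 *: J b0 + (a1 *: b1 + d1 *: J b1) + (a2 *: b2 + d2 *: J b2).
  by rewrite !addrA.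
rewrite sumE => x0.
have [a00 d00] := c0 _ _ _ _ _ _ x0.
move: (x0); rewrite addrC addrA => x2; have [a20 d20] := c2 _ _ _ _ _ _ isT x2.
move: x0; rewrite -addrA addrC => x1; have [a10 d10] := c1 _ _ _ _ _ _ isT x1.
have at_val (i j : 'I_6) : k j = 0 -> val i = val j -> k i = 0.
  by move=> kj /val_inj->.
case=> [[|[|[|[|[|[|//]]]]]] lt_i6].
- exact: at_val a00 _.
- exact: at_val d00 _.
- exact: at_val a10 _.
- exact: at_val d10 _.
- exact: at_val a20 _.
- exact: at_val d20 _.
Qed.

Section FrameTheory.
Variables b0 b1 b2 : W.
Hypothesis bB : basis_of fullv (frame b0 b1 b2).

Local Notation co := (co b0 b1 b2).
Lemma coD k x y : co k (x + y) = co k x + co k y.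
Proof. exact: linearD. Qed.

Lemma coZ k a x : co k (a *: x) = a * co k x.
Proof. exact: linearZ. Qed.

Lemma coN k x : co k (- x) = - co k x.
Proof. exact: linearN. Qed.

Lemma co_exp x : x = co 0 x *: b0 + co 1 x *: J b0
  + (co 2 x *: b1 + co 3 x *: J b1) + (co 4 x *: b2 + co 5 x *: J b2).
Proof.
rewrite {1}(coord_basis bB (memvf x)) /co.
under eq_bigr do rewrite -{1}[X in coord _ X _]inord_val.
by rewrite !big_ord_recl big_ord0 addr0 !addrA.
Qed.

Lemma co_frame k j : (k < 6)%N -> (j < 6)%N -> co k (frame b0 b1 b2)`_j = (k == j)%:R.
Proof.
move=> k6 j6; rewrite /co -[j]/(nat_of_ord (Ordinal j6)) coord_free ?(basis_free bB)//.
by rewrite -val_eqE /= inordK// eq_sym.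
Qed.

Lemma co_b0 k : (k < 6)%N -> co k b0 = (k == 0)%:R.
Proof. by move=> k6; rewrite -[b0]/((frame b0 b1 b2)`_0) co_frame. Qed.
Lemma co_Jb0 k : (k < 6)%N -> co k (J b0) = (k == 1)%:R.
Proof. by move=> k6; rewrite -[J b0]/((frame b0 b1 b2)`_1) co_frame. Qed.
Lemma co_b1 k : (k < 6)%N -> co k b1 = (k == 2)%:R.
Proof. by move=> k6; rewrite -[b1]/((frame b0 b1 b2)`_2) co_frame. Qed.
Lemma co_Jb1 k : (k < 6)%N -> co k (J b1) = (k == 3)%:R.
Proof. by move=> k6; rewrite -[J b1]/((frame b0 b1 b2)`_3) co_frame. Qed.
Lemma co_b2 k : (k < 6)%N -> co k b2 = (k == 4)%:R.
Proof. by move=> k6; rewrite -[b2]/((frame b0 b1 b2)`_4) co_frame. Qed.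
Lemma co_Jb2 k : (k < 6)%N -> co k (J b2) = (k == 5)%:R.
Proof. by move=> k6; rewrite -[J b2]/((frame b0 b1 b2)`_5) co_frame. Qed.

Lemma co_comb a0 d0 a1 d1 a2 d2 k : (k < 6)%N ->
  co k (a0 *: b0 + d0 *: J b0 + (a1 *: b1 + d1 *: J b1) + (a2 *: b2 + d2 *: J b2))
  = [:: a0; d0; a1; d1; a2; d2]`_k.
Proof.
move=> k6; rewrite !coD !coZ co_b0// co_Jb0// co_b1// co_Jb1// co_b2// co_Jb2//.
by case: k k6 => [|[|[|[|[|[|//]]]]]] _; rewrite /= !(mulr0, mulr1, addr0, add0r).
Qed.

Lemma J_exp x : J x = (- co 1 x) *: b0 + co 0 x *: J b0
  + ((- co 3 x) *: b1 + co 2 x *: J b1) + ((- co 5 x) *: b2 + co 4 x *: J b2).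
Proof.
rewrite {1}(co_exp x) !linearD !linearZ /= !JJ !scalerN !scaleNr.
by congr (_ + _ + _); rewrite addrC.
Qed.

Lemma co0J x : co 0 (J x) = - co 1 x. Proof. by rewrite J_exp co_comb. Qed.
Lemma co1J x : co 1 (J x) = co 0 x. Proof. by rewrite J_exp co_comb. Qed.
Lemma co2J x : co 2 (J x) = - co 3 x. Proof. by rewrite J_exp co_comb. Qed.
Lemma co3J x : co 3 (J x) = co 2 x. Proof. by rewrite J_exp co_comb. Qed.
Lemma co4J x : co 4 (J x) = - co 5 x. Proof. by rewrite J_exp co_comb. Qed.
Lemma co5J x : co 5 (J x) = co 4 x. Proof. by rewrite J_exp co_comb. Qed.
Definition coJ := (co0J, co1J, co2J, co3J, co4J, co5J).

(** Real part of the determinant of the complex coordinates of [x], [y], [z];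
    [p i j k] is one of the six products of the Leibniz formula. *)
Definition det_re x y z :=
  let p i j k := co i x * co j y * co k z - co i x * co j.+1 y * co k.+1 z
    - co i.+1 x * co j y * co k.+1 z - co i.+1 x * co j.+1 y * co k z in
  p 0 2 4 + p 2 4 0 + p 4 0 2 - p 0 4 2 - p 4 2 0 - p 2 0 4.

Definition det_im x y z :=
  let p i j k := co i.+1 x * co j y * co k z + co i x * co j.+1 y * co k z
    + co i x * co j y * co k.+1 z - co i.+1 x * co j.+1 y * co k.+1 z in
  p 0 2 4 + p 2 4 0 + p 4 0 2 - p 0 4 2 - p 4 2 0 - p 2 0 4.

(** In complex dimension three there is one complex three-form up to scale, the
    determinant; [T b0 b1 b2] and [T (J b0) b1 b2] are the real part and minus
    the imaginary part of the scale. *)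
Lemma complex_type_det (T : form3 W) x y z : complex_type T ->
  T x y z = T b0 b1 b2 * det_re x y z + T (J b0) b1 b2 * det_im x y z.
Proof.
move=> TJ.
(* The expansions below reproduce these two values, which are therefore given
   abstract names. *)
have [r rE] : {r | T b0 b1 b2 = r} by exists (T b0 b1 b2).
have [s sE] : {s | T (J b0) b1 b2 = s} by exists (T (J b0) b1 b2).
have T12 t : T t b1 b2 = co 0 t * r + co 1 t * s.
  rewrite -rE -sE {1}(co_exp t) !form3E complex_type_line// complex_type_line13//.
  by rewrite form3_alt12 form3_alt13 !mulr0 !addr0.
have T20 t : T t b2 b0 = co 2 t * r + co 3 t * s.
  rewrite -rE -sE {1}(co_exp t) !form3E complex_type_line// complex_type_line13//.
  by rewrite form3_alt12 form3_alt13 (form3_rot T b0 b1 b2) (form3_rot T b0 (J b1) b2) -TJ !mulr0 !addr0 add0r.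
have T01 t : T t b0 b1 = co 4 t * r + co 5 t * s.
  rewrite -rE -sE {1}(co_exp t) !form3E complex_type_line// complex_type_line13//.
  rewrite form3_alt12 form3_alt13 -(form3_rot T b2 b0 b1) -(form3_rot T (J b2) b0 b1).
  by rewrite -complex_typeJ23// -TJ !mulr0 !add0r.
have T21 t : T t b2 b1 = - T t b1 b2 by rewrite form3C23.
have T02 t : T t b0 b2 = - T t b2 b0 by rewrite form3C23.
have T10 t : T t b1 b0 = - T t b0 b1 by rewrite form3C23.
have Tz u t : T u t z = co 0 z * T u t b0 + co 1 z * T (J u) t b0
    + (co 2 z * T u t b1 + co 3 z * T (J u) t b1)
    + (co 4 z * T u t b2 + co 5 z * T (J u) t b2).
  by rewrite {1}(co_exp z) !form3E -!(complex_typeJ23 TJ) -!TJ.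
have Ty u t : T u y t = co 0 y * T u b0 t + co 1 y * T (J u) b0 t
    + (co 2 y * T u b1 t + co 3 y * T (J u) b1 t)
    + (co 4 y * T u b2 t + co 5 y * T (J u) b2 t).
  by rewrite {1}(co_exp y) !form3E -!TJ.
have Ty0 u : T u y b0 = co 4 y * T u b2 b0 + co 5 y * T (J u) b2 b0
    - (co 2 y * T u b0 b1 + co 3 y * T (J u) b0 b1).
  by rewrite Ty !form3_alt23 !T10; ring.
have Ty1 u : T u y b1 = co 0 y * T u b0 b1 + co 1 y * T (J u) b0 b1
    - (co 4 y * T u b1 b2 + co 5 y * T (J u) b1 b2).
  by rewrite Ty !form3_alt23 !T21; ring.
have Ty2 u : T u y b2 = co 2 y * T u b1 b2 + co 3 y * T (J u) b1 b2
    - (co 0 y * T u b2 b0 + co 1 y * T (J u) b2 b0).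
  by rewrite Ty !form3_alt23 !T02; ring.
rewrite rE sE Tz !Ty0 !Ty1 !Ty2 !complex_typeJJ//.
rewrite !T12 !T20 !T01 !coJ.
rewrite /det_re /det_im /=.
move: (co 0 x) (co 1 x) (co 2 x) (co 3 x) (co 4 x) (co 5 x) => x0 x1 x2 x3 x4 x5.
move: (co 0 y) (co 1 y) (co 2 y) (co 3 y) (co 4 y) (co 5 y) => y0 y1 y2 y3 y4 y5.
move: (co 0 z) (co 1 z) (co 2 z) (co 3 z) (co 4 z) (co 5 z) => z0 z1 z2 z3 z4 z5.
ring.
Qed.
End FrameTheory.
End ComplexType.

(** * The stabiliser algebra of [rho] *)
Section Orth.
Variables (R : realType) (W : vectType R) (g : {dot W for idfun}).

Lemma dim_orth2 (U : {vspace W}) a b :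
  (\dim U <= (\dim (U :&: orthov g <[a]> :&: orthov g <[b]>)).+2)%N.
Proof.
apply: leq_trans (leqSpred _) _; rewrite ltnS.
apply: leq_trans (leq_dim_orthov1 g a U) _.
apply: leq_trans (leqSpred _) _; rewrite ltnS.
exact: leq_dim_orthov1.
Qed.

Lemma mem_orth2 (U : {vspace W}) a b x :
  (x \in (U :&: orthov g <[a]> :&: orthov g <[b]>)%VS) =
  [&& x \in U, g x a == 0 & g x b == 0].
Proof. by rewrite !memv_cap !mem_orthov1 andbA. Qed.

Lemma exists_orth2 (U : {vspace W}) a b : (2 < \dim U)%N ->
  exists s, [/\ s \in U, g s s = 1, g s a = 0 & g s b = 0].
Proof.
move=> U3; set V := (U :&: orthov g <[a]> :&: orthov g <[b]>)%VS.
have V0 : V != 0%VS.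
  by rewrite -dimv_eq0 -lt0n -ltnS -ltnS; apply: leq_trans U3 (dim_orth2 _ _ _).
have := memv_pick V; rewrite mem_orth2 => /and3P[sU /eqP sa /eqP sb].
have s0 : 0 < g (vpick V) (vpick V) by apply: neq0_dnorm_gt0; rewrite vpick0.
have k0 : 0 < Num.sqrt (g (vpick V) (vpick V)) by rewrite sqrtr_gt0.
exists ((Num.sqrt (g (vpick V) (vpick V)))^-1 *: vpick V); split.
- by rewrite memvZ.
- rewrite dotZl dotZr -{3}(sqr_sqrtr (Order.POrderTheory.ltW s0)).
  by rewrite expr2 mulKf ?mulVf// Order.POrderTheory.gt_eqF.
- by rewrite dotZl sa mulr0.
- by rewrite dotZl sb mulr0.
Qed.
End Orth.

Section Su3Theory.
Variables (R : realType) (W : vectType R) (g : {dot W for idfun}).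
Variables (J : 'End(W)) (rho : form3 W).
Hypothesis S : su3 g J rho.
Hypothesis dimW : \dim {:W} = 6%N.

Local Notation JJ := (su3JJ S).
Local Notation vec := (vec g rho).

Lemma su3_type : complex_type J rho. Proof. exact: su3rhoJ12 S. Qed.

Lemma su3_gJJ x y : g (J x) (J y) = g x y.
Proof. by rewrite (su3gJ S) JJ dotNr opprK. Qed.

Lemma su3_gxJx x : g x (J x) = 0.
Proof.
have := su3gJ S x x; rewrite dotC => /eqP.
by rewrite -addr_eq0 -mulr2n mulrn_eq0 /= => /eqP.
Qed.

Lemma su3_gJx x y : g x (J y) = - g (J x) y.
Proof. by rewrite (su3gJ S) opprK. Qed.

Lemma vecJl x y : vec (J x) y = - J (vec x y).
Proof.
apply: (dot_inj (g := g)) => z.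
by rewrite dotNl (su3gJ S) opprK !vecE su3_type (complex_typeJ23 su3_type).
Qed.

Lemma vec_norm x y : g (vec x y) (vec x y) =
  g x x * g y y - g x y ^+ 2 - g x (J y) ^+ 2.
Proof. by rewrite (su3vec S) !expr2. Qed.

(** For a unit vector [s] orthogonal to [x] and [J x], [vec x s] has the norm of
    [x]. *)
Lemma rho_nondeg x : (forall y z, rho x y z = 0) -> x = 0.
Proof.
move=> x0; have [|s [_ ss sx sJx]] := @exists_orth2 R W g fullv x (J x).
  by rewrite dimW.
apply: (dot_eq0 (g := g)).
have := vec_norm x s; rewrite vecE x0 ss [g x s]dotC sx su3_gJx [g _ s]dotC sJx.
by rewrite oppr0 expr0n /= !subr0 mulr1 => <-.
Qed.

(** The commutator [C] of [B] and [J] is antilinear, and invariance of [rho]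
    lets it move freely between the arguments of [rho], as [J] does.  Moving
    both back and forth gives [rho (J a) (C b) c] two opposite values. *)
Lemma in_sl_comm (B : 'End(W)) : in_sl rho B -> forall x, B (J x) = J (B x).
Proof.
move=> slB x; apply/eqP; rewrite -subr_eq0; apply/eqP.
pose C x := B (J x) - J (B x).
have TJ := su3_type; have TJ' := complex_typeJ23 TJ.
have C12 a b c : rho (C a) b c = rho a (C b) c.
  have := slB (J a) b c; have := slB a (J b) c; rewrite /act3 /C.
  rewrite !form3D1 !form3D2 form3N1 form3N2.
  rewrite (TJ a (B b) c) (TJ a b (B c)) (TJ (B a) b c).
  lra.
have C23 a b c : rho a (C b) c = rho a b (C c).
  by rewrite -form3_rot C12 form3_rot.
have CJ a : C (J a) = - J (C a).
  by rewrite /C linearB !JJ linearN /= JJ opprK opprD addrC.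
have JC0 a b c : rho (J a) (C b) c = 0.
  have : rho (J a) (C b) c = - rho (J a) (C b) c.
    by rewrite {1}C23 {1}TJ -C23 CJ form3N2 -TJ.
  by move/eqP; rewrite -addr_eq0 -mulr2n mulrn_eq0 /= => /eqP.
apply: rho_nondeg => b c; rewrite -/(C x) form3C12.
by rewrite -[b]opprK -JJ JC0 oppr0.
Qed.
End Su3Theory.

(** For [B] commuting with [J], the three-form [act3 B w] is again of complex
    type, so that two of its values on a complex basis determine it. *)
Section Act3.
Variables (R : realType) (W : vectType R) (B : 'End(W)) (w : form3 W).

Fact act3_linear1 y z : scalar (fun x => act3 B w x y z).
Proof. by move=> a x t; rewrite /act3 [B (a *: x + t)]linearP !form3E; ring. Qed.

Fact act3_linear2 x z : scalar (fun y => act3 B w x y z).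
Proof. by move=> a y t; rewrite /act3 [B (a *: y + t)]linearP !form3E; ring. Qed.

Fact act3_linear3 x y : scalar (act3 B w x y).
Proof. by move=> a z t; rewrite /act3 [B (a *: z + t)]linearP !form3E; ring. Qed.

Fact act3_alt12 x y : act3 B w x x y = 0.
Proof. by rewrite /act3 form3_alt12 (form3C12 w x) opprK subr0 subrr. Qed.

Fact act3_alt23 x y : act3 B w x y y = 0.
Proof.
by rewrite /act3 form3_alt23 (form3C23 w x y (B y)) oppr0 sub0r opprK subrr.
Qed.

Definition act3_form : form3 W :=
  Form3 act3_linear1 act3_linear2 act3_linear3 act3_alt12 act3_alt23.

Lemma act3_complex_type (J : 'End(W)) : complex_type J w ->
  (forall x, B (J x) = J (B x)) -> complex_type J act3_form.
Proof.
move=> TJ BJ x y z; rewrite /= /act3 !BJ.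
by rewrite !TJ.
Qed.
End Act3.

Lemma act3B (R : realType) (W : vectType R) (A B : 'End(W)) (w : form3 W) x y z :
  act3 (A - B) w x y z = act3 A w x y z - act3 B w x y z.
Proof. by rewrite /act3 !add_lfunE !opp_lfunE !form3E; ring. Qed.

(** * The bracket of the Heisenberg algebra plus a centre *)
Lemma exists_endo (R : realType) (W : vectType R) (f : W -> W) : linear f ->
  exists A : 'End(W), forall x, A x = f x.
Proof.
move=> lin; pose fL : {linear W -> W} :=
  HB.pack f (GRing.isLinear.Build _ _ _ _ f lin).
by exists (linfun fL) => x; rewrite lfunE.
Qed.

Lemma exists_riesz (R : realType) (W : vectType R) (g : {dot W for idfun}) (l : W -> R) :
  scalar l -> exists b, forall x, g b x = l x.
Proof.
move=> lin; have linO : linear (l : W -> R^o) by exact: lin.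
pose fL : {linear W -> R^o} :=
  HB.pack (l : W -> R^o) (GRing.isLinear.Build _ _ _ _ (l : W -> R^o) linO).
by exists (sharp g (linfun fL)) => x; rewrite sharpE lfunE.
Qed.

(** The one-forms whose wedge product is [omega] are represented by their dual
    vectors [b] and [c]; [p] and [q] are dual to them. *)
Record heis_bracket (R : realType) (W : vectType R) (g : {dot W for idfun})
    (bu : W -> W -> W) (xi b c p q : W) : Prop := {
  heisE : forall x y, bu x y = (g b x * g c y - g c x * g b y) *: xi;
  heis_xi : g xi xi = 1;
  heis_bxi : g b xi = 0;
  heis_cxi : g c xi = 0;
  heis_bp : g b p = 1;
  heis_bq : g b q = 0;
  heis_cp : g c p = 0;
  heis_cq : g c q = 1
}.

(** The image of the third Heisenberg generator is rescaled to have norm one,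
    and the factor is absorbed into [b] and [p]. *)
Lemma heis_bracketP (R : realType) (W : vectType R) (g : {dot W for idfun})
    (bu : {bilinear W -> W -> W}) : lie_isomorphic bu (@heis_R3_br R) ->
  exists xi b c p q, heis_bracket g bu xi b c p q.
Proof.
case=> f [f' ff' f'f] fbr.
have [b' b'E] : exists b, forall x, g b x = (f x).1 0 0.
  by apply: exists_riesz => a x y; rewrite linearP /= !mxE.
have [c cE] : exists c, forall x, g c x = (f x).1 0 1.
  by apply: exists_riesz => a x y; rewrite linearP /= !mxE.
pose e k : 'rV[R]_3 * 'rV[R]_3 := (delta_mx 0 k, 0).
pose xi' := f' (e 2%:R).
have xi'0 : xi' != 0.
  apply/eqP => x0; have := f'f (e 2%:R).
  rewrite -/xi' x0 linear0 => /(congr1 (fun t : ('rV[R]_3 * 'rV[R]_3)%type => t.1 0 2%:R)).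
  by rewrite !mxE !eqxx /= => /esym/eqP; rewrite oner_eq0.
have n0 : 0 < g xi' xi' by apply: neq0_dnorm_gt0.
pose n := Num.sqrt (g xi' xi'); have n1 : n != 0 by rewrite sqrtr_eq0 -Order.TotalTheory.ltNge.
exists (n^-1 *: xi'), (n *: b'), c, (n^-1 *: f' (e 0)), (f' (e 1)).
split.
- move=> x y; apply: (can_inj ff'); rewrite fbr /heis_R3_br /heis_br.
  rewrite !linearZ /= f'f !dotZl !b'E !cE.
  rewrite scalerA [X in X *: e _](_ : _ = (f x).1 0 0 * (f y).1 0 1 - (f x).1 0 1 * (f y).1 0 0).
    by rewrite /e /=; congr pair => /=; rewrite ?scaler0.
  by field.
- rewrite dotZl dotZr -(sqr_sqrtr (Order.POrderTheory.ltW n0)) -/n; field; exact: n1.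
- by rewrite dotZl dotZr b'E f'f mxE /= !mulr0.
- by rewrite dotZr cE f'f mxE /= !mulr0.
- by rewrite dotZl dotZr b'E f'f mxE /= mulr1 mulfV.
- by rewrite dotZl b'E f'f mxE /= !mulr0.
- by rewrite dotZr cE f'f mxE /= !mulr0.
- by rewrite cE f'f mxE.
Qed.

Section Heis.
Variables (R : realType) (W : vectType R) (g : {dot W for idfun}).
Variables (bu : {bilinear W -> W -> W}) (xi b c p q : W).
Hypothesis H : heis_bracket g bu xi b c p q.

Local Notation D := (lie_derived bu).
Local Notation Z := (lie_center bu).

Definition omega x y := g b x * g c y - g c x * g b y.

Lemma heis_derived : D = <[xi]>%VS.
Proof.
apply/eqP; rewrite eqEsubv; apply/andP; split.
  by apply/lie_prod_subP => x y _ _; rewrite (heisE H) memvZ ?memv_line.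
rewrite -memvE; have -> : xi = bu p q.
  by rewrite (heisE H) (heis_bp H) (heis_cq H) (heis_bq H) mulr0 subr0 mulr1 scale1r.
by apply: memv_lie_prod; rewrite memvf.
Qed.

Lemma heis_centerE : Z = (fullv :&: orthov g <[b]> :&: orthov g <[c]>)%VS.
Proof.
apply/eqP; rewrite eqEsubv; apply/andP; split; apply/subvP => z.
  move/lie_centerP => z0; rewrite mem_orth2 memvf /=.
  have xi0 : xi != 0 by apply: contra_eq_neq (heis_xi H) => ->; rewrite dot0l eq_sym oner_neq0.
  have := z0 p; have := z0 q; rewrite !(heisE H) (heis_bp H) (heis_cq H) (heis_bq H) (heis_cp H).
  rewrite !mul0r !mul1r subr0 sub0r => /eqP; rewrite scaler_eq0 (negPf xi0) orbF oppr_eq0 => /eqP bz /eqP.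
  by rewrite scaler_eq0 (negPf xi0) orbF => /eqP cz; rewrite ![g z _]dotC bz cz eqxx.
rewrite mem_orth2 memvf ![g z _]dotC /= => /andP[/eqP bz /eqP cz].
by apply/lie_centerP => x; rewrite (heisE H) bz cz !mulr0 subr0 scale0r.
Qed.

Lemma heis_mem_center z : z \in Z <-> g b z = 0 /\ g c z = 0.
Proof.
rewrite heis_centerE mem_orth2 memvf ![g z _]dotC /=.
by split=> [/andP[/eqP ? /eqP ?]|[-> ->]]; rewrite ?eqxx.
Qed.

Lemma heis_xi_center : xi \in Z.
Proof. by apply/heis_mem_center; rewrite (heis_bxi H) (heis_cxi H). Qed.

Lemma omega_pq : omega p q = 1.
Proof. by rewrite /omega (heis_bp H) (heis_cq H) (heis_bq H) mulr0 subr0 mulr1. Qed.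

Lemma heis_neq0 : xi != 0.
Proof. by apply: contra_eq_neq (heis_xi H) => ->; rewrite dot0l eq_sym oner_neq0. Qed.

(** The bracket is [omega (x) xi] with [omega] decomposable, so the closedness
    of a three-form reads [omega /\ w (xi, _, _) = 0], which holds iff the
    second factor vanishes on the kernel of the first. *)
Lemma heis_closed3 (w : form3 W) : is_closed3 bu w <->
  {in Z &, forall y z, w xi y z = 0}.
Proof.
split=> [cl y z|w0 x0 x1 x2 x3].
  move=> /heis_mem_center[yb yc] /heis_mem_center[zb zc].
  have := cl p q y z; rewrite /ce_d3 !(heisE H) yb yc zb zc (heis_bp H) (heis_cq H) (heis_bq H) (heis_cp H).
  rewrite !(mulr0, mul0r, mulr1, mul1r, subrr, subr0, sub0r, scale0r, scale1r, form301, oppr0, addr0).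
  by move/eqP; rewrite oppr_eq0 => /eqP.
pose z x := x - g b x *: p - g c x *: q.
have zZ x : z x \in Z.
  apply/heis_mem_center; rewrite /z !dotE (heis_bp H) (heis_cq H) (heis_bq H) (heis_cp H).
  by split; ring.
have wE x y : w xi x y = g b x * w xi p y + g c x * w xi q y
   - g b y * w xi p x - g c y * w xi q x
   - (g b x * g c y - g c x * g b y) * w xi p q.
  have := w0 (z x) (z y) (zZ x) (zZ y).
  rewrite /z !form3E !form3_alt23 (form3C23 w xi p q) (form3C23 w xi p x) (form3C23 w xi q x).
  by move=> e; rewrite -[RHS]addr0 -{1}e; ring.
rewrite /ce_d3 !(heisE H) !form3Z1.
rewrite (wE x2 x3) (wE x1 x3) (wE x1 x2) (wE x0 x3) (wE x0 x2) (wE x0 x1).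
ring.
Qed.
End Heis.

Section HeisSu3.
Variables (R : realType) (W : vectType R) (g : {dot W for idfun}).
Variables (J : 'End(W)) (rho : form3 W).
Hypothesis S : su3 g J rho.
Hypothesis dimW : \dim {:W} = 6%N.
Variables (bu : {bilinear W -> W -> W}) (xi b c p q : W).
Hypothesis H : heis_bracket g bu xi b c p q.
Local Notation D := (lie_derived bu).
Local Notation Z := (lie_center bu).
Local Notation vec := (vec g rho).

Lemma heis_dim_center : (4 <= \dim Z)%N.
Proof. by rewrite (heis_centerE H) -2!ltnS -dimW dim_orth2. Qed.

(** [z |-> vec xi z] maps the centre, of dimension at least four, into its
    orthogonal complement, of dimension at most two; so its kernel on the
    centre has dimension at least two, whereas the whole kernel is spanned by
    [xi] and [J xi]. *)
Lemma center_Jxi : {in Z &, forall y z, rho xi y z = 0} -> J xi \in Z.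
Proof.
move=> rho0.
have [N NE] : exists N : 'End(W), forall x, N x = vec xi x.
  apply: exists_endo => a x y; apply: (dot_inj (g := g)) => t.
  by rewrite dotDl dotZl !vecE !form3E.
have imN : (N @: Z <= orthov g Z)%VS.
  apply/orthovP => _ z /memv_imgP[y yZ ->] zZ.
  by rewrite NE; apply: etrans (vecE g rho xi y z) _; exact: rho0.
have dimO : (\dim (orthov g Z) <= 2)%N.
  have disj : (Z :&: orthov g Z)%VS = 0%VS.
    apply/eqP; rewrite -subv0; apply/subvP => z; rewrite memv_cap memv0 => /andP[zZ].
    by move/mem_orthovP/(_ _ zZ)/dot_eq0 => ->.
  have := dimvS (subvf (Z + orthov g Z)); rewrite dimv_disjoint_sum// dimW.
  by have := heis_dim_center; lia.
have dimK : (2 <= \dim (Z :&: lker N))%N.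
  have := limg_ker_dim N Z; have := dimvS imN; have := heis_dim_center; lia.
have kerN : (Z :&: lker N <= <[xi]> + <[J xi]>)%VS.
  apply/subvP => y; rewrite memv_cap memv_ker NE => /andP[_ /eqP Ny].
  have := vec_norm S xi y; rewrite Ny dot0l (heis_xi H) mul1r => /esym nE.
  suff -> : y = g xi y *: xi + g (J xi) y *: J xi.
    by rewrite memv_add// memvZ ?memv_line.
  apply/eqP; rewrite -subr_eq0; apply/eqP/(dot_eq0 (g := g)).
  rewrite -[RHS]nE !dotE (su3_gJJ S) (su3_gxJx S) (heis_xi H).
  rewrite [g y xi]dotC [g y (J xi)]dotC [g (J xi) xi]dotC (su3_gxJx S) (su3_gJx S xi y).
  ring.
suff : J xi \in (Z :&: lker N)%VS by rewrite memv_cap => /andP[].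
suff -> : (Z :&: lker N)%VS = (<[xi]> + <[J xi]>)%VS.
  by apply: subvP (memv_line _); exact: addvSr.
apply/eqP; rewrite eqEdim kerN /=; apply: leq_trans dimK.
apply: leq_trans (dimv_add_leqif _ _) _; by rewrite !dim_vline -[2%N]/(1 + 1)%N leq_add ?leq_b1.
Qed.
End HeisSu3.

Lemma orthov_dotP (R : realType) (W : vectType R) (g : {dot W for idfun}) (V : {vspace W}) x :
  x \in orthov g V <-> {in V, forall y, g x y = 0}.
Proof. by split=> [/mem_orthovP|xV]; last apply/mem_orthovP. Qed.

(** * Derivations and the affine structure equation *)
Section Derivation.
Variables (R : realType) (W : vectType R) (g : {dot W for idfun}).
Variables (bu : {bilinear W -> W -> W}) (xi b c p q : W).
Hypothesis H : heis_bracket g bu xi b c p q.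
Variable h : 'End(W).
Hypothesis hder : forall x y, h (bu x y) = bu (h x) y + bu x (h y).
Local Notation Z := (lie_center bu).
Local Notation omega := (omega g b c).

Lemma der_center z : z \in Z -> h z \in Z.
Proof.
move=> /lie_centerP zZ; apply/lie_centerP => x.
by have := hder x z; rewrite !zZ linear0 add0r.
Qed.

(** As [omega] is an area form on the quotient by the centre, the eigenvalue of
    [h] on [xi] is the trace of [h] on that quotient. *)
Lemma der_omega x y : omega x y *: h xi = (omega (h x) y + omega x (h y)) *: xi.
Proof. by have := hder x y; rewrite !(heisE H) linearZ -scalerDl. Qed.

Lemma der_xi : exists a, h xi = a *: xi.
Proof.
exists (omega (h p) q + omega p (h q)).
by rewrite -der_omega (omega_pq H) scale1r.
Qed.
End Derivation.

Lemma structure_eq_sl (R : realType) (W : vectType R) (g : {dot W for idfun})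
    (J : 'End(W)) (rho : form3 W) (bu : W -> W -> W) (h A : 'End(W)) :
  structure_eq g J rho bu A ->
  structure_eq g J rho bu h <-> in_sl rho (h - A).
Proof.
move=> EA; split=> [Eh x y z|sl x y z].
  rewrite act3B; apply/eqP; rewrite subr_eq0; apply/eqP.
  by apply: (addIr _ (etrans (Eh x y z) (esym (EA x y z)))).
rewrite -(EA x y z); congr (_ + _).
by apply/eqP; rewrite -subr_eq0 -act3B; apply/eqP.
Qed.

Lemma mem_complex_line (R : realType) (W : vectType R) (J : 'End(W)) v x :
  reflect (exists a d, x = a *: v + d *: J v) (x \in (<[v]> + J @: <[v]>)%VS).
Proof.
rewrite limg_line; apply: (iffP memv_addP) => [[_ /vlineP[a ->] [_ /vlineP[d ->] ->]]|[a [d ->]]].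
  by exists a, d.
by exists (a *: v); rewrite ?memvZ ?memv_line//; exists (d *: J v); rewrite ?memvZ ?memv_line.
Qed.

Lemma co_end (R : realType) (W : vectType R) (J : 'End(W)) (b0 b1 b2 : W) k l u v :
  exists P : 'End(W), forall x, P x = co J b0 b1 b2 k x *: u + co J b0 b1 b2 l x *: v.
Proof.
apply: exists_endo => n x y; rewrite !coD !coZ !scalerDl scalerDr !scalerA.
by rewrite -!addrA; congr (_ + _); rewrite addrCA.
Qed.

(** A sum has dimension at most the sum of the dimensions; when it fills the
    space the bound is an equality, which is directness. *)
Lemma decomposition_dim (R : realType) (V : vectType R) (s : seq {vspace V}) :
  (\sum_(A <- s) A)%VS = fullv -> (\sum_(A <- s) \dim A <= \dim {:V})%N ->
  is_decomposition s.
Proof.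
move=> sE dE; split=> //; rewrite directvE /= sE eqn_leq dE andbT.
by rewrite -sE; exact: dimv_leq_sum.
Qed.

Lemma dim_complex_line (R : realType) (V : vectType R) (u v : V) :
  (\dim (<[u]> + <[v]>) <= 2)%N.
Proof.
apply: leq_trans (dimv_add_leqif _ _) _.
by rewrite !dim_vline -[2%N]/(1 + 1)%N leq_add ?leq_b1.
Qed.

Lemma complex_scale (R : realType) (V : vectType R) (J : 'End(V)) :
  (forall x, J (J x) = - x) -> forall (l m a d : R) v,
  l *: (a *: v + d *: J v) + m *: J (a *: v + d *: J v) =
  (l * a - m * d) *: v + (l * d + m * a) *: J v.
Proof.
move=> JJ l m a d v; have -> : J (a *: v + d *: J v) = a *: J v - d *: v.
  by rewrite linearD !linearZ /= JJ scalerN.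
rewrite !scalerDr scalerN !scalerA !scalerDl scaleNr.
by rewrite [X in _ + X]addrC addrACA.
Qed.

Lemma complex_lineJ (R : realType) (V : vectType R) (J : 'End(V)) :
  (forall x, J (J x) = - x) -> forall (a d : R) v,
  J (a *: v + d *: J v) = (- d) *: v + a *: J v.
Proof.
by move=> JJ a d v; rewrite linearD !linearZ /= JJ scalerN scaleNr addrC.
Qed.

(** * The case of a J-invariant centre *)

(** For a central unit vector [s] orthogonal to [xi] and [J xi], the vectors
    [xi], [s], [t = vec xi s] form a unitary basis with complex volume one, and
    U1, U2, U3 are their complex lines. *)
Section JInvariantCenter.
Variables (R : realType) (W : vectType R) (g : {dot W for idfun}).
Variables (J : 'End(W)) (rho : form3 W).
Hypothesis S : su3 g J rho.
Hypothesis dimW : \dim {:W} = 6%N.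
Variables (bu : {bilinear W -> W -> W}) (xi b c p q : W).
Hypothesis H : heis_bracket g bu xi b c p q.
Local Notation D := (lie_derived bu).
Local Notation Z := (lie_center bu).
Local Notation U1 := (D + J @: D)%VS.
Local Notation U2 := (orthov g U1 :&: Z)%VS.
Local Notation U3 := (orthov g Z).
Local Notation vec := (vec g rho).
Local Notation omega := (omega g b c).

Variable s : W.
Hypotheses (sZ : s \in Z) (ss : g s s = 1) (sxi : g s xi = 0) (sJxi : g s (J xi) = 0).
Hypothesis JZ : forall z, z \in Z -> J z \in Z.
Let t := vec xi s.
Let JJ := su3JJ S.
Let xixi := heis_xi H.
Let xiZ := heis_xi_center H.

Lemma jinv_xis : g xi s = 0. Proof. by rewrite dotC. Qed.
Lemma jinv_xiJs : g xi (J s) = 0. Proof. by rewrite (su3_gJx S) dotC sJxi oppr0. Qed.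
Lemma jinv_sJs : g s (J s) = 0. Proof. exact: su3_gxJx S _. Qed.
Lemma jinv_xiJxi : g xi (J xi) = 0. Proof. exact: su3_gxJx S _. Qed.
Lemma jinv_tJt : g t (J t) = 0. Proof. exact: su3_gxJx S _. Qed.
Lemma jinv_tt : g t t = 1.
Proof.
by rewrite /t (vec_norm S) xixi ss jinv_xis jinv_xiJs expr0n /= !subr0 mulr1.
Qed.
Lemma jinv_tv v : g t v = rho xi s v. Proof. by rewrite /t vecE. Qed.
Let TJ := su3_type S.
Lemma jinv_txi : g t xi = 0. Proof. by rewrite jinv_tv form3_alt13. Qed.
Lemma jinv_ts : g t s = 0. Proof. by rewrite jinv_tv form3_alt23. Qed.
Lemma jinv_tJxi : g t (J xi) = 0.
Proof. by rewrite jinv_tv -(complex_typeJ23 TJ) -TJ (complex_type_line13 TJ). Qed.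
Lemma jinv_tJs : g t (J s) = 0.
Proof. by rewrite jinv_tv -(complex_typeJ23 TJ) -form3_rot (complex_type_line TJ). Qed.

Definition jinv_gram := (xixi, ss, jinv_tt, jinv_xis, sxi, jinv_xiJs, sJxi,
  jinv_sJs, jinv_xiJxi, jinv_tJt, jinv_txi, jinv_ts, jinv_tJxi, jinv_tJs).

Lemma jinv_xit : g xi t = 0. Proof. by rewrite dotC jinv_gram. Qed.
Lemma jinv_st : g s t = 0. Proof. by rewrite dotC jinv_gram. Qed.
Lemma jinv_xiJt : g xi (J t) = 0. Proof. by rewrite (su3_gJx S) dotC jinv_gram oppr0. Qed.
Lemma jinv_sJt : g s (J t) = 0. Proof. by rewrite (su3_gJx S) dotC jinv_gram oppr0. Qed.

Lemma jinv_rho : rho xi s t = 1. Proof. by rewrite -jinv_tv jinv_gram. Qed.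
Lemma jinv_rhoJ : rho (J xi) s t = 0.
Proof. by rewrite TJ (complex_typeJ23 TJ) -jinv_tv jinv_gram. Qed.

Lemma jinv_basis : basis_of fullv (frame J xi s t).
Proof. by apply: (frame_basis JJ TJ dimW); rewrite jinv_rho oner_neq0. Qed.
Let fB := jinv_basis.
Local Notation co := (co J xi s t).

Lemma jinv_rhoE x y z : rho x y z = det_re J xi s t x y z.
Proof. by rewrite (complex_type_det JJ fB _ _ _ TJ) jinv_rho jinv_rhoJ mul1r mul0r addr0. Qed.

Definition jinv_gram2 := (jinv_gram, jinv_xit, jinv_st, jinv_xiJt, jinv_sJt).

Lemma jinv_co x : [/\ g x xi = co 0 x, g x (J xi) = co 1 x, g x s = co 2 x
  & [/\ g x (J s) = co 3 x, g x t = co 4 x & g x (J t) = co 5 x]].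
Proof.
rewrite {1 3 5 7 9 11}(co_exp fB x) !dotDl !dotZl !(su3_gJJ S) !(su3gJ S) !jinv_gram2.
by do !split; ring.
Qed.

Lemma jinv_gxiJ x : g xi (J x) = - co 1 x.
Proof. by rewrite (su3_gJx S) dotC; have [_ -> _ _] := jinv_co x. Qed.

Definition jinv_kappa := omega t (J t).

(** The complex lines of [xi] and [s] are central, so only coordinates along
    [t] enter. *)
Lemma jinv_omega x y : omega x y = jinv_kappa * (co 4 x * co 5 y - co 5 x * co 4 y).
Proof.
have [bs cs] := (heis_mem_center H s).1 sZ.
have [bJs cJs] := (heis_mem_center H _).1 (JZ sZ).
have [bJ cJ] := (heis_mem_center H _).1 (JZ xiZ).
have e v : g v xi = 0 -> g v (J xi) = 0 -> g v s = 0 -> g v (J s) = 0 ->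
  forall x, g v x = co 4 x * g v t + co 5 x * g v (J t).
  move=> h1 h2 h3 h4 {}x; rewrite {1}(co_exp fB x) !dotDr !dotZr h1 h2 h3 h4; ring.
have eb := e b (heis_bxi H) bJ bs bJs; have ec := e c (heis_cxi H) cJ cs cJs.
by rewrite /jinv_kappa /omega (eb x) (eb y) (ec x) (ec y); ring.
Qed.

Lemma jinv_kappa_neq0 : jinv_kappa != 0.
Proof.
have := omega_pq H; rewrite jinv_omega => e; apply: contra_eq_neq e => ->.
by rewrite mul0r eq_sym oner_neq0.
Qed.

Lemma jinv_center x : x \in Z <-> co 4 x = 0 /\ co 5 x = 0.
Proof.
split=> [/lie_centerP xZ|[x4 x5]].
  have := xZ t; have := xZ (J t); rewrite !(heisE H) -!/(omega _ _) !jinv_omega.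
  rewrite !co_b2// !co_Jb2//= !mul0r !mul1r !subr0 !sub0r => /eqP.
  rewrite scaler_eq0 (negPf (heis_neq0 H)) orbF mulf_eq0 (negPf jinv_kappa_neq0) /=.
  rewrite oppr_eq0 => /eqP-> /eqP.
  by rewrite scaler_eq0 (negPf (heis_neq0 H)) orbF mulf_eq0 (negPf jinv_kappa_neq0) /= => /eqP ->.
apply/lie_centerP => y; rewrite (heisE H) -/(omega y x) jinv_omega x4 x5.
by rewrite !mulr0 subrr mulr0 scale0r.
Qed.

Lemma jinv_rho0 : {in Z &, forall y z, rho xi y z = 0}.
Proof.
move=> y z /jinv_center[y4 y5] /jinv_center[z4 z5].
by rewrite jinv_rhoE /det_re !co_b0//= y4 y5 z4 z5; ring.
Qed.

Lemma jinv_U1 x : x \in U1 <-> x = co 0 x *: xi + co 1 x *: J xi.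
Proof.
rewrite (heis_derived H); split=> [/mem_complex_line[a [d ->]]|->]; last first.
  by apply/mem_complex_line; exists (co 0 x), (co 1 x).
by rewrite !coD !coZ !co_b0// !co_Jb0//= !mulr0 !mulr1 addr0 add0r.
Qed.

Lemma jinv_U2 x : x \in U2 <-> x = co 2 x *: s + co 3 x *: J s.
Proof.
have [x0 x1 x2 [x3 x4 x5]] := jinv_co x.
split=> [|xE].
  rewrite memv_cap => /andP[/orthov_dotP xU /jinv_center[x40 x50]].
  have x00 : co 0 x = 0 by rewrite -x0; apply: xU; rewrite (heis_derived H) memvE addvSl.
  have x10 : co 1 x = 0.
    by rewrite -x1; apply: xU; rewrite (heis_derived H) limg_line memvE addvSr.
  by rewrite {1}(co_exp fB x) x00 x10 x40 x50 !scale0r !addr0 add0r.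
rewrite memv_cap; apply/andP; split; last by rewrite xE memvD ?memvZ ?JZ.
apply/orthov_dotP => y; rewrite (heis_derived H) => /mem_complex_line[a [d ->]].
rewrite dotDr !dotZr xE !dotDl !dotZl (su3_gJJ S) (su3gJ S) !jinv_gram2; ring.
Qed.

Lemma jinv_U3 x : x \in U3 <-> x = co 4 x *: t + co 5 x *: J t.
Proof.
have [x0 x1 x2 [x3 x4 x5]] := jinv_co x.
split=> [/orthov_dotP xU|xE].
  have x00 : co 0 x = 0 by rewrite -x0; apply: xU.
  have x10 : co 1 x = 0 by rewrite -x1; apply: xU; apply: JZ.
  have x20 : co 2 x = 0 by rewrite -x2; apply: xU.
  have x30 : co 3 x = 0 by rewrite -x3; apply: xU; apply: JZ.
  by rewrite {1}(co_exp fB x) x00 x10 x20 x30 !scale0r !addr0 !add0r.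
apply/orthov_dotP => y /jinv_center[y4 y5].
rewrite (co_exp fB y) y4 y5 !scale0r !addr0 xE !dotDr !dotDl !dotZr !dotZl.
rewrite !(su3_gJJ S) !(su3gJ S) !jinv_gram2; ring.
Qed.


Lemma jinv_decomposition : is_decomposition [:: U1; U2; U3].
Proof.
have sub2 (U : {vspace W}) u v : (forall x, x \in U -> exists a d, x = a *: u + d *: v) ->
    (\dim U <= 2)%N.
  move=> UE; apply: leq_trans (dim_complex_line u v); apply: dimvS.
  by apply/subvP => x /UE[a [d ->]]; rewrite memv_add ?memvZ ?memv_line.
apply: decomposition_dim; last first.
  rewrite !big_cons big_nil addn0 dimW -[6%N]/(2 + (2 + 2))%N; do ?apply: leq_add.
  - by apply: sub2 => x /jinv_U1 ->; do 2!eexists.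
  - by apply: sub2 => x /jinv_U2 ->; do 2!eexists.
  - by apply: sub2 => x /jinv_U3 ->; do 2!eexists.
rewrite !big_cons big_nil addv0; apply/eqP; rewrite eqEsubv subvf; apply/subvP => x _.
rewrite (co_exp fB x) -addrA; apply: memv_add; last apply: memv_add.
- by apply/jinv_U1; rewrite !coD !coZ !co_b0// !co_Jb0//= !mulr0 !mulr1 addr0 add0r.
- by apply/jinv_U2; rewrite !coD !coZ !co_b1// !co_Jb1//= !mulr0 !mulr1 addr0 add0r.
- by apply/jinv_U3; rewrite !coD !coZ !co_b2// !co_Jb2//= !mulr0 !mulr1 addr0 add0r.
Qed.

Variable A : 'End(W).
Hypothesis AE : forall x, A x = (jinv_kappa / 2) *: (co 4 x *: s - co 5 x *: J s).

Lemma jinv_coA x : [/\ co 0 (A x) = 0, co 1 (A x) = 0, co 2 (A x) = jinv_kappa / 2 * co 4 x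
  & [/\ co 3 (A x) = - (jinv_kappa / 2 * co 5 x), co 4 (A x) = 0 & co 5 (A x) = 0]].
Proof.
rewrite AE !coZ !coD !coN !coZ !co_b1// !co_Jb1//=.
by do !split; ring.
Qed.

(** [d sigma] is a multiple of the wedge product of the coordinates along [J xi],
    [t] and [J t].  The antilinear map [A] from the line of [t] to that of [s]
    produces it, [t] and [J t] contributing half of the coefficient each. *)
Lemma jinv_structure_A : structure_eq g J rho bu A.
Proof.
move=> x y z; rewrite /act3 !jinv_rhoE !(heisE H) -!/(omega _ _) !dotZl.
rewrite !jinv_gxiJ !jinv_omega /det_re.
have [-> -> -> [-> -> ->]] := jinv_coA x.
have [-> -> -> [-> -> ->]] := jinv_coA y.
have [-> -> -> [-> -> ->]] := jinv_coA z.
by field.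
Qed.

(** For [x] in the complex line of [t] with squared norm [n], the bracket
    of [x] and [J x] is [jinv_kappa * n *: xi] and [vec xi x] has squared norm
    [n]; hence [hat_map] is linear, with coefficient [- jinv_kappa / 2]. *)
Lemma jinv_hat x : x \in U3 -> hat_map bu g rho J x = A x.
Proof.
move=> /jinv_U3 xE; rewrite /hat_map; case: eqVneq => [->|x0].
  by rewrite linear0.
pose a := co 4 x; pose d := co 5 x; pose n := a ^+ 2 + d ^+ 2.
have n0 : n != 0.
  apply: contra_neq x0 => /eqP; rewrite paddr_eq0 ?sqr_ge0// !expf_eq0 /= => /andP[/eqP a0 /eqP d0].
  by rewrite xE -/a -/d a0 d0 !scale0r addr0.
have bE : bu x (J x) = (jinv_kappa * n) *: xi.
  rewrite (heisE H) -/(omega _ _) jinv_omega !(co4J JJ fB) !(co5J JJ fB) -/a -/d /n.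
  by congr (_ *: _); ring.
pose w := a *: s - d *: J s.
have vE : sharp g (linfun (rho (bu x (J x)) x : W -> R^o)) = (- (jinv_kappa * n)) *: w.
  apply: (dot_inj (g := g)) => y; have [y0 y1 y2 [y3 y4 y5]] := jinv_co y.
  rewrite -/(vec (bu x (J x)) x) vecE bE form3Z1 jinv_rhoE dotC dotZr /w !dotE y2 y3.
  rewrite /det_re -/a -/d xE !coD !coZ !co_b0// !co_b2// !co_Jb2//=; ring.
rewrite vE bE !dotZl !dotZr xixi scalerA AE -/w.
have wE : g w w = n.
  rewrite /w !dotE (su3_gJJ S) (su3gJ S) !jinv_gram /n; ring.
by rewrite wE; congr (_ *: _); have k0 := jinv_kappa_neq0; field; rewrite k0 n0.
Qed.

Variable h : 'End(W).
Hypothesis hder : forall x y, h (bu x y) = bu (h x) y + bu x (h y).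

Definition jinv_block : Prop :=
  exists (lambda mu : R) (h12 h13 h23 : 'End(W)),
       [/\ is_Jlinear_on J U2 U1 h12, is_Jlinear_on J U3 U1 h13,
           is_Jlinear_on J U3 U2 h23
         & forall x1 x2 x3, x1 \in U1 -> x2 \in U2 -> x3 \in U3 ->
           h (x1 + x2 + x3) =
             (- 2 * lambda *: x1 + h12 x2 + h13 x3)
             + (3 * lambda *: x2 + mu *: J x2
                + (h23 x3 + hat_map bu g rho J x3))
             + (- lambda *: x3 - mu *: J x3)].

(** [B = h - A] is complex linear and upper triangular, with diagonal entries
    [a], [co 2 (B s) + i co 3 (B s)] and [co 4 (B t) + i co 5 (B t)].  The complex
    trace of [B] is zero, and [a] is the real trace of [h] on the quotient
    by the centre, which is the line of [t]. *)
Lemma jinv_fwd : structure_eq g J rho bu h -> jinv_block.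
Proof.
move=> Eh; have sl := (structure_eq_sl h jinv_structure_A).1 Eh.
pose B := h - A.
have BE x : B x = h x - A x by rewrite /B add_lfunE opp_lfunE.
have BJ : forall x, B (J x) = J (B x) := in_sl_comm S dimW sl.
have hE x : h x = B x + A x by rewrite BE subrK.
have AZ x : x \in Z -> A x = 0.
  by move=> /jinv_center[x4 x5]; rewrite AE x4 x5 !scale0r subrr scaler0.
have [a hxi] := der_xi H hder.
have Bxi : B xi = a *: xi by rewrite BE AZ// subr0.
have /jinv_center[Bs4 Bs5] : B s \in Z by rewrite BE AZ// subr0 (der_center hder).
have tr0 : a + co 2 (B s) + co 4 (B t) = 0.
  have := sl xi s t; rewrite /act3 -/B Bxi !jinv_rhoE /det_re !coZ.
  rewrite !co_b0// !co_b1// !co_b2//= => e.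
  by apply/eqP; rewrite -oppr_eq0; apply/eqP; rewrite -[RHS]e; ring.
have tr1 : co 3 (B s) + co 5 (B t) = 0.
  have := sl (J xi) s t; rewrite /act3 -/B BJ Bxi linearZ /= !jinv_rhoE /det_re !coZ.
  rewrite !co_Jb0// !co_b1// !co_b2//= => e.
  by rewrite -[RHS]e; ring.
have tra : a = 2 * co 4 (B t).
  have k0 := jinv_kappa_neq0.
  have e := der_omega H hder t (J t); rewrite hxi scalerA in e.
  have {}e : omega t (J t) * a = omega (h t) (J t) + omega t (h (J t)).
    apply/eqP; rewrite -subr_eq0; have := heis_neq0 H.
    by move=> x0; have /eqP := e; rewrite -subr_eq0 -scalerBl scaler_eq0 (negPf x0) orbF.
  move: e; rewrite -/jinv_kappa !hE !jinv_omega !coD BJ !(co4J JJ fB) !(co5J JJ fB).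
  have [_ _ _ [_ -> ->]] := jinv_coA t.
  have [_ _ _ [_ -> ->]] := jinv_coA (J t).
  rewrite !co_b2//= => e.
  by apply: (mulfI k0); rewrite e; ring.
have [P0 P0E] := co_end J xi s t 0 1 xi (J xi).
have [P1 P1E] := co_end J xi s t 2 3 s (J s).
have P0U x : P0 x \in U1.
  by apply/jinv_U1; rewrite P0E !coD !coZ !co_b0// !co_Jb0//= !mulr0 !mulr1 addr0 add0r.
have P1U x : P1 x \in U2.
  by apply/jinv_U2; rewrite P1E !coD !coZ !co_b1// !co_Jb1//= !mulr0 !mulr1 addr0 add0r.
have P0J x : P0 (J x) = J (P0 x).
  by rewrite !P0E linearD !linearZ /= JJ (co0J JJ fB) (co1J JJ fB) scalerN scaleNr addrC.
have P1J x : P1 (J x) = J (P1 x).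
  by rewrite !P1E linearD !linearZ /= JJ !(co2J JJ fB) !(co3J JJ fB) scalerN scaleNr addrC.
exists (- co 4 (B t)), (co 3 (B s)), (P0 \o B)%VF, (P0 \o B)%VF, (P1 \o B)%VF.
split.
- by split=> [|x _]; [apply/subvP => _ /memv_imgP[x _ ->]|]; rewrite !comp_lfunE /= ?P0U// BJ P0J.
- by split=> [|x _]; [apply/subvP => _ /memv_imgP[x _ ->]|]; rewrite !comp_lfunE /= ?P0U// BJ P0J.
- by split=> [|x _]; [apply/subvP => _ /memv_imgP[x _ ->]|]; rewrite !comp_lfunE /= ?P1U// BJ P1J.
move=> x1 x2 x3 /jinv_U1 x1E /jinv_U2 x2E x3U; rewrite !linearD /= (jinv_hat x3U).
have x1Z : x1 \in Z by rewrite x1E memvD ?memvZ ?JZ.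
have x2Z : x2 \in Z by rewrite x2E memvD ?memvZ ?JZ.
rewrite !hE (AZ x1)// (AZ x2)// !addr0 !comp_lfunE.
have x3E := (jinv_U3 x3).1 x3U.
have Bc v m n : B (m *: v + n *: J v) = m *: B v + n *: J (B v).
  by rewrite linearD !linearZ /= BJ.
have Pdec x : x = P0 x + P1 x + (co 4 x *: t + co 5 x *: J t).
  by rewrite {1}(co_exp fB x) P0E P1E.
have -> : B x1 = - 2 * - co 4 (B t) *: x1.
  rewrite {1}x1E Bc Bxi [J (a *: _)]linearZ /= !scalerA {3}x1E scalerDr !scalerA tra.
  by congr (_ *: _ + _ *: _); ring.
have e2 : B x2 = P0 (B x2) + (3 * - co 4 (B t) *: x2 + co 3 (B s) *: J x2).
  have cs l m : l *: x2 + m *: J x2 =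
      (l * co 2 x2 - m * co 3 x2) *: s + (l * co 3 x2 + m * co 2 x2) *: J s.
    by rewrite {1 2}x2E (complex_scale JJ).
  have Bx2 : B x2 = co 2 x2 *: B s + co 3 x2 *: J (B s) by rewrite {1}x2E Bc.
  rewrite {1}(Pdec (B x2)) cs P1E -addrA; congr (_ + _).
  rewrite Bx2 !coD !coZ !(co2J JJ fB) !(co3J JJ fB) !(co4J JJ fB) !(co5J JJ fB).
  rewrite Bs4 Bs5 oppr0 !mulr0 addr0 !scale0r !addr0.
  have s2 : co 2 (B s) = 3 * - co 4 (B t).
    by apply/eqP; rewrite -subr_eq0 -tr0 tra; apply/eqP; ring.
  by congr (_ *: _ + _ *: _); rewrite s2; ring.
have e3 : B x3 = P0 (B x3) + P1 (B x3) + (- - co 4 (B t) *: x3 - co 3 (B s) *: J x3).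
  have cs l m : l *: x3 + m *: J x3 =
      (l * co 4 x3 - m * co 5 x3) *: t + (l * co 5 x3 + m * co 4 x3) *: J t.
    by rewrite {1 2}x3E (complex_scale JJ).
  have Bx3 : B x3 = co 4 x3 *: B t + co 5 x3 *: J (B t) by rewrite {1}x3E Bc.
  rewrite {1}(Pdec (B x3)) -!scaleNr cs; congr (_ + _).
  rewrite Bx3 !coD !coZ !(co4J JJ fB) !(co5J JJ fB).
  have s3 : co 3 (B s) = - co 5 (B t) by apply/eqP; rewrite -addr_eq0 tr1.
  by congr (_ *: _ + _ *: _); rewrite s3; ring.
have zm (v0 v1 v2 v3 v4 v5 v6 : W) : v0 + (v1 + v2) + (v3 + v4 + v5 + v6)
    = v0 + v1 + v3 + (v2 + (v4 + v6)) + v5.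
  by rewrite -!addrA (addrCA v2 v3) (addrC v5 v6).
by rewrite {1}e2 {1}e3 zm.
Qed.

(** [h - A] is complex linear with complex trace
    [- 2 l + (3 l + i m) - (l + i m) = 0]. *)
Lemma jinv_bwd : jinv_block -> structure_eq g J rho bu h.
Proof.
move=> [l [m [h12 [h13 [h23 [[U12 J12] [U13 J13] [U23 J23] hE]]]]]].
apply/(structure_eq_sl h jinv_structure_A).
pose B := h - A.
have BE x : B x = h x - A x by rewrite /B add_lfunE opp_lfunE.
have AZ x : x \in Z -> A x = 0.
  by move=> /jinv_center[x4 x5]; rewrite AE x4 x5 !scale0r subrr scaler0.
have U1Z x : x \in U1 -> x \in Z.
  by move/jinv_U1 ->; rewrite memvD ?memvZ ?JZ.
have U2Z x : x \in U2 -> x \in Z.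
  by move/jinv_U2 ->; rewrite memvD ?memvZ ?JZ.
have Bx x1 x2 x3 : x1 \in U1 -> x2 \in U2 -> x3 \in U3 ->
  B (x1 + x2 + x3) = (- 2 * l *: x1 + h12 x2 + h13 x3)
     + (3 * l *: x2 + m *: J x2 + h23 x3) + (- l *: x3 - m *: J x3).
  move=> x1U x2U x3U; rewrite BE hE// (jinv_hat x3U).
  have -> : A (x1 + x2 + x3) = A x3.
    by rewrite [LHS]linearD /= [X in X + _]linearD /= (AZ x1) ?U1Z// (AZ x2) ?U2Z// !add0r.
  by rewrite addrAC !addrA addrK.
have JU1 x : x \in U1 -> J x \in U1.
  by move=> /jinv_U1 xE; apply/jinv_U1; rewrite (co0J JJ fB) (co1J JJ fB) {1}xE (complex_lineJ JJ).
have JU2 x : x \in U2 -> J x \in U2.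
  by move=> /jinv_U2 xE; apply/jinv_U2; rewrite (co2J JJ fB) (co3J JJ fB) {1}xE (complex_lineJ JJ).
have JU3 x : x \in U3 -> J x \in U3.
  by move=> /jinv_U3 xE; apply/jinv_U3; rewrite (co4J JJ fB) (co5J JJ fB) {1}xE (complex_lineJ JJ).
have xiU : xi \in U1.
  by apply/jinv_U1; rewrite co_b0// co_b0//= scale1r scale0r addr0.
have sU : s \in U2.
  by apply/jinv_U2; rewrite co_b1// co_b1//= scale1r scale0r addr0.
have tU : t \in U3.
  by apply/jinv_U3; rewrite co_b2// co_b2//= scale1r scale0r addr0.
have BJ x : B (J x) = J (B x).
  pose x1 := co 0 x *: xi + co 1 x *: J xi.
  pose x2 := co 2 x *: s + co 3 x *: J s.
  pose x3 := co 4 x *: t + co 5 x *: J t.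
  have x1U : x1 \in U1 by rewrite memvD ?memvZ ?JU1.
  have x2U : x2 \in U2 by rewrite memvD ?memvZ ?JU2.
  have x3U : x3 \in U3 by rewrite memvD ?memvZ ?JU3.
  have xE : x = x1 + x2 + x3 by rewrite {1}(co_exp fB x).
  have -> : J x = J x1 + J x2 + J x3 by rewrite {1}xE !linearD.
  rewrite {1}xE !Bx ?JU1 ?JU2 ?JU3// J12// J13// J23//.
  have jD u v : J (u + v) = J u + J v by rewrite linearD.
  have jN u : J (- u) = - J u by rewrite linearN.
  have jZ n u : J (n *: u) = n *: J u by rewrite linearZ.
  by clearbody x1 x2 x3; rewrite !jD !jN !jZ.
have B1 : B xi = - 2 * l *: xi.
  have := Bx xi 0 0 xiU (mem0v _) (mem0v _).
  by rewrite !linear0 !(addr0, subr0).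
have B2 : B s = h12 s + (3 * l *: s + m *: J s).
  have := Bx 0 s 0 (mem0v _) sU (mem0v _).
  by rewrite !linear0 !(addr0, subr0, add0r).
have B3 : B t = h13 t + h23 t + (- l *: t - m *: J t).
  have := Bx 0 0 t (mem0v _) (mem0v _) tU.
  by rewrite !linear0 !(addr0, subr0, add0r).
have h12s : h12 s \in U1 by apply: (subvP U12); rewrite memv_img.
have h13t : h13 t \in U1 by apply: (subvP U13); rewrite memv_img.
have h23t : h23 t \in U2 by apply: (subvP U23); rewrite memv_img.
have c2 : co 2 (B s) = 3 * l /\ co 3 (B s) = m.
  rewrite B2 ((jinv_U1 _).1 h12s) !coD !coZ !co_b0// !co_Jb0// !co_b1// !co_Jb1//=.
  by split; ring.
have c3 : co 4 (B t) = - l /\ co 5 (B t) = - m.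
  rewrite B3 ((jinv_U1 _).1 h13t) ((jinv_U2 _).1 h23t) !coD !coN !coZ.
  rewrite !co_b0// !co_Jb0// !co_b1// !co_Jb1// !co_b2// !co_Jb2//=.
  by split; ring.
case: c2 c3 => c2 c2' [c3 c3'] x y z.
have := complex_type_det JJ fB x y z (act3_complex_type TJ BJ).
rewrite /= => ->.
have -> : act3 B rho xi s t = 0.
  rewrite /act3 B1 !jinv_rhoE /det_re !coZ.
  by rewrite !co_b0// !co_b1// !co_b2//= c2 c2' c3 c3'; ring.
have -> : act3 B rho (J xi) s t = 0.
  rewrite /act3 BJ B1 !jinv_rhoE /det_re [J (_ *: xi)]linearZ /= !coZ.
  by rewrite !co_Jb0// !co_b1// !co_b2//= c2 c2' c3 c3'; ring.
by rewrite !mul0r addr0.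
Qed.

End JInvariantCenter.

(** * The case of a centre that is not J-invariant *)

(** Here U2 is a totally real plane with basis [z1], [z2], and the complex volume
    of [xi], [z1], [z2] is purely imaginary by the condition on [rho]. *)
Section TotallyRealCenter.
Variables (R : realType) (W : vectType R) (g : {dot W for idfun}).
Variables (J : 'End(W)) (rho : form3 W).
Hypothesis S : su3 g J rho.
Hypothesis dimW : \dim {:W} = 6%N.
Variables (bu : {bilinear W -> W -> W}) (xi b c p q : W).
Hypothesis H : heis_bracket g bu xi b c p q.
Local Notation D := (lie_derived bu).
Local Notation Z := (lie_center bu).
Local Notation U1 := (D + J @: D)%VS.
Local Notation U2 := (orthov g U1 :&: Z)%VS.
Local Notation omega := (omega g b c).

Variables z1 z2 : W.
Hypotheses (JxiZ : J xi \in Z) (z1U : z1 \in U2) (z2U : z2 \in U2).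
Variable r : R.
Hypotheses (rho0 : rho xi z1 z2 = 0) (rhoJ : rho (J xi) z1 z2 = r) (r0 : r != 0).
Let JJ := su3JJ S.
Let xixi := heis_xi H.
Let xiZ := heis_xi_center H.
Let TJ := su3_type S.

Lemma mem_U2 x : x \in U2 <-> [/\ g xi x = 0, g (J xi) x = 0 & x \in Z].
Proof.
rewrite memv_cap; split=> [/andP[/orthov_dotP xU xZ]|[x0 x1 xZ]].
  split=> //; rewrite dotC xU// (heis_derived H) ?limg_line memvE ?addvSl ?addvSr//.
apply/andP; split=> //; apply/orthov_dotP => y.
rewrite (heis_derived H) => /mem_complex_line[a [d ->]].
by rewrite dotC !dotE x0 x1 !mulr0 addr0.
Qed.

Lemma treal_basis : basis_of fullv (frame J xi z1 z2).
Proof. by apply: (frame_basis JJ TJ dimW); rewrite rhoJ r0 orbT. Qed.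
Let fB := treal_basis.
Local Notation co := (co J xi z1 z2).

Lemma treal_rhoE x y z : rho x y z = r * det_im J xi z1 z2 x y z.
Proof. by rewrite (complex_type_det JJ fB _ _ _ TJ) rho0 rhoJ mul0r add0r. Qed.

Lemma treal_co0 x : g xi x = co 0 x.
Proof.
have [a1 a2 _] := (mem_U2 z1).1 z1U; have [c1 c2 _] := (mem_U2 z2).1 z2U.
rewrite {1}(co_exp fB x) !dotDr !dotZr xixi (su3_gxJx S) !(su3_gJx S xi).
by rewrite a1 a2 c1 c2; ring.
Qed.

Lemma treal_co1 x : g (J xi) x = co 1 x.
Proof. by rewrite (su3gJ S) treal_co0 (co0J JJ fB) opprK. Qed.

Definition treal_kappa := omega (J z1) (J z2).

Lemma treal_omega x y : omega x y = treal_kappa * (co 3 x * co 5 y - co 5 x * co 3 y).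
Proof.
have [_ _ z1Z] := (mem_U2 z1).1 z1U; have [_ _ z2Z] := (mem_U2 z2).1 z2U.
have [b1 c1] := (heis_mem_center H _).1 z1Z.
have [b2 c2] := (heis_mem_center H _).1 z2Z.
have [bJ cJ] := (heis_mem_center H _).1 JxiZ.
have e v : g v xi = 0 -> g v (J xi) = 0 -> g v z1 = 0 -> g v z2 = 0 ->
  forall x, g v x = co 3 x * g v (J z1) + co 5 x * g v (J z2).
  move=> h1 h2 h3 h4 {}x; rewrite {1}(co_exp fB x) !dotDr !dotZr h1 h2 h3 h4; ring.
have eb := e b (heis_bxi H) bJ b1 b2; have ec := e c (heis_cxi H) cJ c1 c2.
by rewrite /treal_kappa /omega (eb x) (eb y) (ec x) (ec y); ring.
Qed.

Lemma treal_kappa_neq0 : treal_kappa != 0.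
Proof.
have := omega_pq H; rewrite treal_omega => e; apply: contra_eq_neq e => ->.
by rewrite mul0r eq_sym oner_neq0.
Qed.

Lemma treal_center x : x \in Z <-> co 3 x = 0 /\ co 5 x = 0.
Proof.
split=> [/lie_centerP xZ|[x3 x5]].
  have := xZ (J z1); have := xZ (J z2); rewrite !(heisE H) -!/(omega _ _) !treal_omega.
  rewrite !co_Jb1// !co_Jb2//= !mul0r !mul1r !subr0 !sub0r => /eqP.
  rewrite scaler_eq0 (negPf (heis_neq0 H)) orbF mulf_eq0 (negPf treal_kappa_neq0) /=.
  rewrite oppr_eq0 => /eqP-> /eqP.
  by rewrite scaler_eq0 (negPf (heis_neq0 H)) orbF mulf_eq0 (negPf treal_kappa_neq0) /= => /eqP ->.
apply/lie_centerP => y; rewrite (heisE H) -/(omega y x) treal_omega x3 x5.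
by rewrite !mulr0 subrr mulr0 scale0r.
Qed.

Lemma treal_D x : x \in D <-> x = co 0 x *: xi.
Proof.
rewrite (heis_derived H); split=> [/vlineP[a ->]|->]; last by rewrite memvZ ?memv_line.
by rewrite coZ co_b0//= mulr1.
Qed.

Lemma treal_JD x : x \in (J @: D)%VS <-> x = co 1 x *: J xi.
Proof.
rewrite (heis_derived H) limg_line; split=> [/vlineP[a ->]|->]; last by rewrite memvZ ?memv_line.
by rewrite coZ co_Jb0//= mulr1.
Qed.

Lemma treal_U2 x : x \in U2 <-> x = co 2 x *: z1 + co 4 x *: z2.
Proof.
split=> [/mem_U2[]|xE]; last by rewrite xE memvD ?memvZ.
rewrite treal_co0 treal_co1 => x0 x1 /treal_center[x3 x5].
by rewrite {1}(co_exp fB x) x0 x1 x3 x5 !scale0r !addr0 add0r.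
Qed.

Lemma treal_JU2 x : x \in (J @: U2)%VS <-> x = co 3 x *: J z1 + co 5 x *: J z2.
Proof.
split=> [/memv_imgP[y /treal_U2 yE ->]|->]; last by rewrite memvD ?memvZ ?memv_img.
rewrite {1}yE [LHS]linearD /= !(co3J JJ fB) !(co5J JJ fB).
by congr (_ + _); rewrite [LHS]linearZ.
Qed.

Lemma treal_basisU2 : basis_of U2 [:: z1; z2].
Proof.
have free12 : free [tuple z1; z2].
  apply/freeP => k; rewrite !big_ord_recl big_ord0 addr0 /= => k0.
  have c0 l : co l 0 = 0 by exact: linear0.
  have := congr1 (co 2) k0; have := congr1 (co 4) k0.
  rewrite !c0 !coD !coZ !co_b1// !co_b2//= !(mulr0, mulr1, addr0, add0r).
  move=> k1 k2; have at_val (i j : 'I_2) : k j = 0 -> val i = val j -> k i = 0.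
    by move=> kj /val_inj->.
  by case=> [[|[|//]] lt_i2]; [apply: at_val k2 _ | apply: at_val k1 _].
rewrite /basis_of free12 andbT eqEsubv; apply/andP; split; apply/subvP => x.
  by rewrite span_cons span_seq1 => /memv_addP[_ /vlineP[a ->] [_ /vlineP[d ->] ->]]; rewrite memvD ?memvZ.
move=> /treal_U2 ->; rewrite span_cons span_seq1.
by rewrite memv_add ?memvZ ?memv_line.
Qed.

Lemma treal_decomposition : is_decomposition [:: D; J @: D; U2; J @: U2]%VS.
Proof.
have line (V : {vspace W}) u : (forall x, x \in V -> exists a, x = a *: u) -> (\dim V <= 1)%N.
  move=> VE; apply: leq_trans (_ : \dim <[u]> <= 1)%N; last by rewrite dim_vline leq_b1.
  by apply/dimvS/subvP => x /VE[a ->]; rewrite memvZ ?memv_line.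
have plane (V : {vspace W}) u v : (forall x, x \in V -> exists a d, x = a *: u + d *: v) ->
    (\dim V <= 2)%N.
  move=> VE; apply: leq_trans (dim_complex_line u v); apply: dimvS.
  by apply/subvP => x /VE[a [d ->]]; rewrite memv_add ?memvZ ?memv_line.
apply: decomposition_dim; last first.
  rewrite !big_cons big_nil addn0 dimW -[6%N]/(1 + (1 + (2 + 2)))%N; do ?apply: leq_add.
  - by apply: line => x /treal_D ->; eexists.
  - by apply: line => x /treal_JD ->; eexists.
  - by apply: plane => x /treal_U2 ->; do 2!eexists.
  - by apply: plane => x /treal_JU2 ->; do 2!eexists.
rewrite !big_cons big_nil addv0; apply/eqP; rewrite eqEsubv subvf; apply/subvP => x _.
rewrite (co_exp fB x) -!addrA.
have -> (v1 v2 v3 v4 v5 v6 : W) : v1 + (v2 + (v3 + (v4 + (v5 + v6)))) = v1 + (v2 + ((v3 + v5) + (v4 + v6))).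
  by rewrite -!addrA (addrCA v4 v5).
have xiD : xi \in D by rewrite (heis_derived H) memv_line.
by do ?apply: memv_add; rewrite ?memvD ?memvZ ?memv_img.
Qed.

Lemma treal_vec : sharp g (linfun (rho z1 z2 : W -> R^o)) = r *: J xi.
Proof.
apply: (dot_inj (g := g)) => x.
rewrite -/(vec g rho z1 z2) vecE dotZl treal_co1 treal_rhoE /det_im.
by rewrite !co_b1// !co_b2//=; ring.
Qed.

(** Both sides of the equation defining [lambda] are alternating in the two
    basis vectors of U2, so it suffices to compare them for one basis. *)
Lemma treal_lambda_iff l :
  (forall y1 y2, basis_of U2 [:: y1; y2] ->
     - 8 * l *: sharp g (linfun (rho y1 y2 : W -> R^o)) = J (bu (J y1) (J y2))) <->
  - 8 * l * r = treal_kappa.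
Proof.
have J0 : J xi != 0.
  apply: contra_neq (heis_neq0 H) => J0; apply/eqP; rewrite -oppr_eq0; apply/eqP.
  by rewrite -JJ J0 linear0.
split=> [/(_ _ _ treal_basisU2)|lE y1 y2 yB].
  rewrite treal_vec (heisE H) -/treal_kappa scalerA [RHS]linearZ /= => /eqP.
  by rewrite -subr_eq0 -scalerBl scaler_eq0 (negPf J0) orbF subr_eq0 => /eqP.
have y1U : y1 \in U2 by apply: (basis_mem yB); rewrite !inE eqxx.
have y2U : y2 \in U2 by apply: (basis_mem yB); rewrite !inE eqxx orbT.
have y1E := (treal_U2 _).1 y1U; have y2E := (treal_U2 _).1 y2U.
rewrite (heisE H) -/(omega _ _) treal_omega.
rewrite !(co3J JJ fB) !(co5J JJ fB) -lE [RHS]linearZ /=.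
apply: (dot_inj (g := g)) => x.
rewrite !dotZl -/(vec g rho y1 y2) vecE treal_co1 treal_rhoE /det_im.
rewrite y1E y2E !coD !coZ !co_b1// !co_b2//=; ring.
Qed.


Variable l : R.
Hypothesis lE : - 8 * l * r = treal_kappa.

Lemma treal_diag : exists A : 'End(W), forall x, A x =
  - 2 * l *: (co 0 x *: xi) - 6 * l *: (co 1 x *: J xi)
  + 3 * l *: (co 2 x *: z1 + co 4 x *: z2) - l *: (co 3 x *: J z1 + co 5 x *: J z2).
Proof.
have [P0 P0E] := co_end J xi z1 z2 0 0 xi 0; have [P1 P1E] := co_end J xi z1 z2 1 1 (J xi) 0.
have [P2 P2E] := co_end J xi z1 z2 2 4 z1 z2; have [P3 P3E] := co_end J xi z1 z2 3 5 (J z1) (J z2).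
exists (- 2 * l *: P0 - 6 * l *: P1 + 3 * l *: P2 - l *: P3) => x.
by rewrite !add_lfunE !opp_lfunE !scale_lfunE P0E P1E P2E P3E !scaler0 !addr0.
Qed.

Variable A : 'End(W).
Hypothesis AE : forall x, A x =
  - 2 * l *: (co 0 x *: xi) - 6 * l *: (co 1 x *: J xi)
  + 3 * l *: (co 2 x *: z1 + co 4 x *: z2) - l *: (co 3 x *: J z1 + co 5 x *: J z2).

Lemma treal_coA x :
  [/\ co 0 (A x) = - 2 * l * co 0 x, co 1 (A x) = - 6 * l * co 1 x,
      co 2 (A x) = 3 * l * co 2 x
    & [/\ co 3 (A x) = - l * co 3 x, co 4 (A x) = 3 * l * co 4 x
        & co 5 (A x) = - l * co 5 x]].
Proof.
rewrite AE !(coD, coN, coZ) !co_b0// !co_Jb0// !co_b1// !co_Jb1// !co_b2// !co_Jb2//=.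
by do !split; ring.
Qed.

(** Of the four real monomials of [rho] in the adapted coframe, [A] kills three,
    since [- 6 + 3 + 3 = 0] and [- 2 + 3 - 1 = 0]; it multiplies the remaining
    one, dual to [J xi], [J z1], [J z2], by [- 6 - 1 - 1 = - 8] times [l], up to
    sign.  That monomial is also the only one in [d sigma]. *)
Lemma treal_structure_A : structure_eq g J rho bu A.
Proof.
move=> x y z; rewrite /act3 !treal_rhoE !(heisE H) -!/(omega _ _) !dotZl.
rewrite !treal_co0 !(co0J JJ fB) !treal_omega -lE /det_im.
have [-> -> -> [-> -> ->]] := treal_coA x.
have [-> -> -> [-> -> ->]] := treal_coA y.
have [-> -> -> [-> -> ->]] := treal_coA z.
ring.
Qed.

Lemma treal_A_sum x1 x2 x3 x4 :
  x1 \in D -> x2 \in (J @: D)%VS -> x3 \in U2 -> x4 \in (J @: U2)%VS ->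
  A (x1 + x2 + x3 + x4) = - 2 * l *: x1 - 6 * l *: x2 + 3 * l *: x3 - l *: x4.
Proof.
move=> /treal_D -> /treal_JD -> /treal_U2 -> /treal_JU2 ->.
set a := co 0 x1; set d := co 1 x2.
set a1 := co 2 x3; set a2 := co 4 x3; set d1 := co 3 x4; set d2 := co 5 x4.
rewrite AE !(coD, coZ) !co_b0// !co_Jb0// !co_b1// !co_Jb1// !co_b2// !co_Jb2//=.
by rewrite !(mulr0, mulr1, addr0, add0r).
Qed.

Variable h : 'End(W).
Hypothesis hder : forall x y, h (bu x y) = bu (h x) y + bu x (h y).

(** [B = h - A] is complex linear and acts on [xi] by [a + 2 l].  This number is
    the trace of [B] on U2 modulo U1, by the derivation property, and also its
    opposite, since the complex trace of [B] is zero. *)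
Lemma treal_fwd : structure_eq g J rho bu h ->
  exists h1 : 'End(W),
   [/\ in_sl rho h1, (U1 <= lker h1)%VS, (h1 @: Z <= Z)%VS &
       forall x1 x2 x3 x4,
         x1 \in D -> x2 \in (J @: D)%VS -> x3 \in U2 -> x4 \in (J @: U2)%VS ->
         h (x1 + x2 + x3 + x4) =
           (- 2 * l *: x1 - 6 * l *: x2 + 3 * l *: x3 - l *: x4)
           + h1 (x1 + x2 + x3 + x4)].
Proof.
move=> Eh; have sl := (structure_eq_sl h treal_structure_A).1 Eh.
pose B := h - A.
have BE x : B x = h x - A x by rewrite /B add_lfunE opp_lfunE.
have BJ : forall x, B (J x) = J (B x) := in_sl_comm S dimW sl.
have hE x : h x = B x + A x by rewrite BE subrK.
have BZ x : x \in Z -> B x \in Z.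
  move=> xZ; apply/treal_center; have [h3 h5] := (treal_center _).1 (der_center hder xZ).
  have [x3 x5] := (treal_center _).1 xZ.
  have [_ _ _ [A3 _ A5]] := treal_coA x.
  by rewrite BE !coD !coN h3 h5 A3 A5 x3 x5 !mulr0 subrr.
have [_ _ z1Z] := (mem_U2 z1).1 z1U; have [_ _ z2Z] := (mem_U2 z2).1 z2U.
have [B13 B15] := (treal_center _).1 (BZ _ z1Z).
have [B23 B25] := (treal_center _).1 (BZ _ z2Z).
have [a hxi] := der_xi H hder.
have Bxi : B xi = (a + 2 * l) *: xi.
  have := AE xi; rewrite !co_b0//= !scale0r !addr0 !scaler0 !subr0 !addr0 scale1r => Axi.
  by rewrite BE hxi Axi mulNr scaleNr opprK scalerDl.
have tr : a + 2 * l + co 2 (B z1) + co 4 (B z2) = 0.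
  have := sl (J xi) z1 z2; rewrite /act3 -/B BJ Bxi [J (_ *: _)]linearZ /= !treal_rhoE /det_im !coZ.
  rewrite !co_Jb0// !co_b1// !co_b2//= B13 B15 B23 B25 => e.
  by apply: (mulfI r0); rewrite mulr0 -[RHS]oppr0 -[in RHS]e; ring.
have tra : a + 2 * l = co 2 (B z1) + co 4 (B z2).
  have e := der_omega H hder (J z1) (J z2); rewrite hxi scalerA in e.
  have {}e : omega (J z1) (J z2) * a = omega (h (J z1)) (J z2) + omega (J z1) (h (J z2)).
    apply/eqP; rewrite -subr_eq0; have := heis_neq0 H.
    by move=> x0; have /eqP := e; rewrite -subr_eq0 -scalerBl scaler_eq0 (negPf x0) orbF.
  move: e; rewrite -/treal_kappa !hE !treal_omega !coD !BJ !(co3J JJ fB) !(co5J JJ fB).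
  have [_ _ _ [-> _ ->]] := treal_coA (J z1).
  have [_ _ _ [-> _ ->]] := treal_coA (J z2).
  rewrite !co_Jb1// !co_Jb2// !co_b1// !co_b2//= => e.
  by apply: (mulfI treal_kappa_neq0); rewrite mulrDr e; ring.
have a0 : a + 2 * l = 0.
  have : (a + 2 * l) *+ 2 = 0 by rewrite mulr2n -[RHS]tr [in X in _ + X]tra addrA.
  by move/eqP; rewrite mulrn_eq0 /= => /eqP.
have {}Bxi : B xi = 0 by rewrite Bxi a0 scale0r.
exists B; split=> //.
- apply/subvP => x; rewrite (heis_derived H) => /mem_complex_line[m [n ->]].
  by rewrite memv_ker linearD !linearZ /= BJ Bxi !linear0 addr0.
- by apply/subvP => _ /memv_imgP[x xZ ->]; apply: BZ.
- by move=> x1 x2 x3 x4 x1U x2U x3U x4U; rewrite -treal_A_sum// hE addrC.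
Qed.

Lemma treal_bwd (h1 : 'End(W)) : in_sl rho h1 ->
  (forall x1 x2 x3 x4,
     x1 \in D -> x2 \in (J @: D)%VS -> x3 \in U2 -> x4 \in (J @: U2)%VS ->
     h (x1 + x2 + x3 + x4) =
       (- 2 * l *: x1 - 6 * l *: x2 + 3 * l *: x3 - l *: x4)
       + h1 (x1 + x2 + x3 + x4)) ->
  structure_eq g J rho bu h.
Proof.
move=> sl hE; apply/(structure_eq_sl h treal_structure_A).
suff -> : h - A = h1 by [].
apply/lfunP => x; rewrite add_lfunE opp_lfunE.
have xiD : xi \in D by rewrite (heis_derived H) memv_line.
have -> : x = co 0 x *: xi + co 1 x *: J xi + (co 2 x *: z1 + co 4 x *: z2)
    + (co 3 x *: J z1 + co 5 x *: J z2).
  by rewrite {1}(co_exp fB x) -!addrA [co 3 x *: _ + (co 4 x *: _ + _)]addrCA.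
rewrite hE ?treal_A_sum ?memvD ?memvZ ?memv_img//.
by rewrite addrAC subrr add0r.
Qed.

End TotallyRealCenter.

(** * The two cases together *)
Section TotallyRealFrame.
Variables (R : realType) (W : vectType R) (g : {dot W for idfun}).
Variables (J : 'End(W)) (rho : form3 W).
Hypothesis S : su3 g J rho.
Hypothesis dimW : \dim {:W} = 6%N.
Variables (bu : {bilinear W -> W -> W}) (xi b c p q : W).
Hypothesis H : heis_bracket g bu xi b c p q.
Local Notation D := (lie_derived bu).
Local Notation Z := (lie_center bu).
Local Notation U1 := (D + J @: D)%VS.
Local Notation U2 := (orthov g U1 :&: Z)%VS.

(** If the complex volume of [xi], [z1], [z2] were zero for an orthogonal pair
    [z1], [z2] in U2, then [z2] would be a multiple of [J z1], and the centre,
    spanned by [xi], [J xi], [z1], [J z1], would be [J]-invariant. *)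
Lemma treal_frame : J xi \in Z -> ~ (J @: Z <= Z)%VS ->
  {in Z &, forall y z, rho xi y z = 0} ->
  exists z1 z2, [/\ z1 \in U2, z2 \in U2, rho xi z1 z2 = 0 & rho (J xi) z1 z2 != 0].
Proof.
move=> JxiZ nJZ rho0.
have memU := mem_U2 J H.
have dimU2 : (2 <= \dim U2)%N.
  have := dim_orth2 g Z xi (J xi); have := heis_dim_center dimW H.
  have : (Z :&: orthov g <[xi]> :&: orthov g <[J xi]> <= U2)%VS.
    apply/subvP => x; rewrite mem_orth2 => /and3P[xZ /eqP x0 /eqP x1].
    by apply/memU; rewrite !(dotC g _ x).
  move/dimvS; lia.
pose z1 := vpick U2; pose V := (U2 :&: orthov g <[z1]>)%VS; pose z2 := vpick V.
have z1U : z1 \in U2 by apply: memv_pick.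
have z10 : z1 != 0 by rewrite vpick0 -dimv_eq0 -lt0n; apply: leq_trans dimU2.
have V0 : V != 0%VS.
  rewrite -dimv_eq0 -lt0n; apply: leq_trans (leq_dim_orthov1 g z1 U2).
  by move: dimU2; case: (\dim _) => [|[|]].
have z20 : z2 != 0 by rewrite vpick0.
have [z2U z21] : z2 \in U2 /\ g z2 z1 = 0.
  by have := memv_pick V; rewrite memv_cap mem_orthov1 => /andP[? /eqP].
have [a1 a2 z1Z] := (memU z1).1 z1U; have [c1 c2 z2Z] := (memU z2).1 z2U.
exists z1, z2; split=> //; first exact: rho0.
apply/eqP => rJ0; apply: nJZ.
have [JJ TJ] := (su3JJ S, su3_type S).
set t := vec g rho xi z1; pose n := rho xi z1 t.
have n0 : n != 0.
  rewrite /n -(vecE g) (vec_norm S) (heis_xi H) a1 (su3_gJx S) a2 oppr0 expr0n /= !subr0 mul1r.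
  by apply: contra_neq z10; apply: dot_eq0.
have nJ : rho (J xi) z1 t = 0.
  by rewrite -(vecE g) (vecJl S) -/t dotNl dotC (su3_gxJx S) oppr0.
have fB : basis_of fullv (frame J xi z1 t).
  by apply: (frame_basis JJ TJ dimW); rewrite -/n n0.
have co4 x : rho xi z1 x = n * co J xi z1 t 4 x.
  rewrite (complex_type_det JJ fB _ _ _ TJ) nJ -/n /det_re.
  by rewrite !co_b0// !co_b1//=; ring.
have co5 x : rho (J xi) z1 x = - (n * co J xi z1 t 5 x).
  rewrite (complex_type_det JJ fB _ _ _ TJ) nJ -/n /det_re.
  by rewrite !co_Jb0// !co_b1//=; ring.
have z24 : co J xi z1 t 4 z2 = 0 by apply: (mulfI n0); rewrite -co4 rho0// mulr0.
have z25 : co J xi z1 t 5 z2 = 0 by apply: (mulfI n0); apply: oppr_inj; rewrite -co5 rJ0 mulr0 oppr0.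
have JzZ : J z1 \in Z.
  have z2E := co_exp fB z2; rewrite z24 z25 !scale0r !addr0 in z2E.
  have xx := heis_xi H; have xJ := su3_gxJx S xi; have zJ := su3_gxJx S z1.
  have z2xi : co J xi z1 t 0 z2 = 0.
    have := c1; rewrite {1}z2E !dotDr !dotZr xx xJ a1 (su3_gJx S xi z1) a2.
    by rewrite oppr0 !mulr0 !addr0 mulr1.
  have z2Jxi : co J xi z1 t 1 z2 = 0.
    have := c2; rewrite {1}z2E !dotDr !dotZr (su3_gJJ S) (su3gJ S) xx xJ a2 (su3_gJJ S) a1.
    by rewrite oppr0 !mulr0 !addr0 add0r mulr1.
  have z2z1 : co J xi z1 t 2 z2 = 0.
    have := z21; rewrite {1}z2E z2xi z2Jxi !scale0r !add0r dotDl !dotZl (dotC g (J z1)) zJ mulr0 addr0.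
    by move/eqP; rewrite mulf_eq0 => /orP[/eqP //|/eqP/dot_eq0 z1_0]; rewrite z1_0 eqxx in z10.
  rewrite z2xi z2Jxi z2z1 !scale0r !add0r in z2E.
  have k0 : co J xi z1 t 3 z2 != 0 by apply: contra_neq z20 => k0; rewrite z2E k0 scale0r.
  by rewrite -[J z1]scale1r -(mulVf k0) -scalerA -z2E memvZ.
apply/subvP => _ /memv_imgP[x xZ ->].
have x4 : co J xi z1 t 4 x = 0 by apply: (mulfI n0); rewrite -co4 rho0// mulr0.
have x5 : co J xi z1 t 5 x = 0.
  by apply: (mulfI n0); apply: oppr_inj; rewrite -co5 TJ rho0// mulr0 oppr0.
have xiZ := heis_xi_center H.
have -> : J x = co J xi z1 t 0 x *: J xi + co J xi z1 t 1 x *: J (J xi)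
   + (co J xi z1 t 2 x *: J z1 + co J xi z1 t 3 x *: J (J z1)).
  by rewrite {1}(co_exp fB x) x4 x5 !scale0r !addr0 !linearD !linearZ.
by rewrite !JJ !memvD ?memvZ ?memvN.
Qed.
End TotallyRealFrame.

Section Equivalence.
Variables (R : realType) (W : vectType R) (g : {dot W for idfun}).
Variables (J : 'End(W)) (rho : form3 W).
Hypothesis S : su3 g J rho.
Hypothesis dimW : \dim {:W} = 6%N.
Variables (bu : {bilinear W -> W -> W}) (xi b c p q : W).
Hypothesis H : heis_bracket g bu xi b c p q.
Variable h : 'End(W).
Hypothesis hder : forall x y, h (bu x y) = bu (h x) y + bu x (h y).
Local Notation D := (lie_derived bu).
Local Notation Z := (lie_center bu).
Local Notation U1 := (D + J @: D)%VS.
Local Notation U2 := (orthov g U1 :&: Z)%VS.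
Local Notation U3 := (orthov g Z).

Lemma JD_subP : (J @: D <= Z)%VS <-> J xi \in Z.
Proof. by rewrite (heis_derived H) limg_line -memvE. Qed.

Lemma jinv_iff : J xi \in Z -> (J @: Z <= Z)%VS ->
  is_decomposition [:: U1; U2; U3] /\ {in Z &, forall y z, rho xi y z = 0} /\
  (structure_eq g J rho bu h <-> jinv_block g J rho bu h).
Proof.
move=> JxiZ /subvP JZ.
have {}JZ z : z \in Z -> J z \in Z by move=> zZ; apply: JZ; rewrite memv_img.
have Z2 : (2 < \dim Z)%N by have := heis_dim_center dimW H; lia.
have [s [sZ ss sxi sJxi]] := exists_orth2 g xi (J xi) Z2.
pose co := co J xi s (vec g rho xi s).
have [A AE] : exists A : 'End(W), forall x, A x =
    (jinv_kappa g J rho xi b c s / 2) *: (co 4 x *: s - co 5 x *: J s).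
  have [P PE] := co_end J xi s (vec g rho xi s) 4 5 s (- J s).
  exists ((jinv_kappa g J rho xi b c s / 2) *: P) => x.
  by rewrite scale_lfunE PE scalerN.
split; first exact: (jinv_decomposition S dimW H sZ ss sxi sJxi JZ).
split; first exact: (jinv_rho0 S dimW H sZ ss sxi sJxi JZ).
split; first exact: (jinv_fwd S dimW H sZ ss sxi sJxi JZ AE hder).
exact: (jinv_bwd S dimW H sZ ss sxi sJxi JZ AE).
Qed.

Definition treal_block : Prop :=
  exists (lambda : R) (h1 : 'End(W)),
   [/\ in_sl rho h1, (U1 <= lker h1)%VS, (h1 @: Z <= Z)%VS,
       forall x1 x2 x3 x4,
         x1 \in D -> x2 \in (J @: D)%VS -> x3 \in U2 -> x4 \in (J @: U2)%VS ->
         h (x1 + x2 + x3 + x4) =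
           (- 2 * lambda *: x1 - 6 * lambda *: x2 + 3 * lambda *: x3
            - lambda *: x4) + h1 (x1 + x2 + x3 + x4)
     & forall z1 z2, basis_of U2 [:: z1; z2] ->
         - 8 * lambda *: sharp g (linfun (rho z1 z2 : W -> R^o))
         = J (bu (J z1) (J z2))].

Lemma treal_iff : J xi \in Z -> ~ (J @: Z <= Z)%VS ->
  {in Z &, forall y z, rho xi y z = 0} ->
  is_decomposition [:: D; J @: D; U2; J @: U2]%VS /\
  (structure_eq g J rho bu h <-> treal_block).
Proof.
move=> JxiZ nJZ rho0.
have [z1 [z2 [z1U z2U r0 rJ]]] := treal_frame S dimW H JxiZ nJZ rho0.
have rE := erefl (rho (J xi) z1 z2).
have iffL := treal_lambda_iff S dimW H JxiZ z1U z2U r0 rE rJ.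
split; first exact: (treal_decomposition S dimW H JxiZ z1U z2U rE rJ).
split=> [Eh|[l [h1 [sl _ _ hE /iffL lE]]]].
  pose l := - (treal_kappa g J b c z1 z2) / (8 * rho (J xi) z1 z2).
  have lE : - 8 * l * rho (J xi) z1 z2 = treal_kappa g J b c z1 z2.
    by rewrite /l; field.
  have [A AE] := treal_diag J xi z1 z2 l.
  have [h1 [sl k1 k2 hE]] := treal_fwd S dimW H JxiZ z1U z2U r0 rE rJ lE AE hder Eh.
  by exists l, h1; split=> //; apply/iffL.
have [A AE] := treal_diag J xi z1 z2 l.
exact: (treal_bwd S dimW H JxiZ z1U z2U r0 rE rJ lE AE sl hE).
Qed.

Lemma rho_DZZ : {in Z &, forall y z, rho xi y z = 0} <->
  (forall x y z, x \in D -> y \in Z -> z \in Z -> rho x y z = 0).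
Proof.
split=> [r0 x y z|r0 y z yZ zZ].
  by rewrite (heis_derived H) => /vlineP[a ->] yZ zZ; rewrite form3Z1 r0// mulr0.
by apply: r0 => //; rewrite (heis_derived H) memv_line.
Qed.

Lemma closed_iff_block : is_closed3 bu rho /\ structure_eq g J rho bu h <->
  (J @: D <= Z)%VS /\
  ([/\ (J @: Z <= Z)%VS, is_decomposition [:: U1; U2; U3] & jinv_block g J rho bu h]
   \/
   [/\ ~ (J @: Z <= Z)%VS,
       forall x y z, x \in D -> y \in Z -> z \in Z -> rho x y z = 0,
       is_decomposition [:: D; J @: D; U2; J @: U2]%VS
     & treal_block]).
Proof.
split=> [[/(heis_closed3 H) rho0 Eh]|[/JD_subP JxiZ]].
  have JxiZ := center_Jxi S dimW H rho0.
  split; first exact/JD_subP.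
  case: (boolP (J @: Z <= Z)%VS) => [JZ|/negP nJZ].
    by left; have [dec [_ iffI]] := jinv_iff JxiZ JZ; split=> //; apply/iffI.
  right; have [dec iffII] := treal_iff JxiZ nJZ rho0.
  by split=> //; [apply/rho_DZZ | apply/iffII].
case=> [[JZ _ blk]|[nJZ /rho_DZZ rho0 _ blk]].
  have [_ [rho0 iffI]] := jinv_iff JxiZ JZ.
  by split; [apply/(heis_closed3 H) | apply/iffI].
have [_ iffII] := treal_iff JxiZ nJZ rho0.
by split; [apply/(heis_closed3 H) | apply/iffII].
Qed.
End Equivalence.

Theorem corollary4p8 (R : realType) (g : vectType R)
    (br : {bilinear g -> g -> g}) (Hbr : is_lie_bracket br)
    (Hdimg : \dim {:g} = 7%N)
    (u : {vspace g}) (Hideal : is_ideal br u) (Hdimu : (\dim u).+1 = \dim {:g})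
    (Hnil : is_nilpotent (restr_br u br))
    (Hiso : lie_isomorphic (restr_br u br) (@heis_R3_br R))
    (phi : form3 g) (Hphi : is_G2_structure phi)
    (gm : {dot g for idfun}) (Hgm : is_G2_metric phi gm)
    (X : g) (HXu : X \in orthov gm u) (HX1 : gm X X = 1)
    (sigma : form2 (subvs_of u)) (rho : form3 (subvs_of u))
    (J : 'End(subvs_of u)) (HSU3 : is_induced_SU3 gm phi X sigma rho J) :
  let bu := restr_br u br in
  let gu := restr_dot u gm : {dot subvs_of u for idfun} in
  let h := restr_ad u br X in
  let D := lie_derived bu in
  let Z := lie_center bu in
  let U1 := (D + J @: D)%VS in
  let U2 := (orthov gu U1 :&: Z)%VS in
  let U3 := orthov gu Z in
  is_closed3 br phi <->
  (J @: D <= Z)%VS /\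
  ([/\ (J @: Z <= Z)%VS,
       is_decomposition [:: U1; U2; U3]
     & exists (lambda mu : R) (h12 h13 h23 : 'End(subvs_of u)),
       [/\ is_Jlinear_on J U2 U1 h12, is_Jlinear_on J U3 U1 h13,
           is_Jlinear_on J U3 U2 h23
         & forall x1 x2 x3, x1 \in U1 -> x2 \in U2 -> x3 \in U3 ->
           h (x1 + x2 + x3) =
             (- 2 * lambda *: x1 + h12 x2 + h13 x3)
             + (3 * lambda *: x2 + mu *: J x2
                + (h23 x3 + hat_map bu gu rho J x3))
             + (- lambda *: x3 - mu *: J x3)]]
   \/
   [/\ ~ (J @: Z <= Z)%VS,
       forall x y z, x \in D -> y \in Z -> z \in Z -> rho x y z = 0,
       is_decomposition [:: D; J @: D; U2; J @: U2]%VS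
     & exists (lambda : R) (h1 : 'End(subvs_of u)),
       [/\ in_sl rho h1, (U1 <= lker h1)%VS, (h1 @: Z <= Z)%VS,
           forall x1 x2 x3 x4,
             x1 \in D -> x2 \in (J @: D)%VS -> x3 \in U2 -> x4 \in (J @: U2)%VS ->
             h (x1 + x2 + x3 + x4) =
               (- 2 * lambda *: x1 - 6 * lambda *: x2 + 3 * lambda *: x3
                - lambda *: x4) + h1 (x1 + x2 + x3 + x4)
         & forall z1 z2, basis_of U2 [:: z1; z2] ->
             - 8 * lambda *: sharp gu (linfun (rho z1 z2 : subvs_of u -> R^o))
             = J (bu (J z1) (J z2))]]).
Proof.
move=> bu gu h D Z U1 U2 U3.
have S : su3 gu J rho := induced_su3 Hdimu HXu HX1 Hgm HSU3.
have dimW : \dim {:subvs_of u} = 6%N.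
  by apply/eqP; rewrite dimvf; apply/eqP; move: Hdimu; rewrite Hdimg => -[].
have [xi [b [c [p [q H]]]]] := heis_bracketP gu Hiso.
have hder := restr_ad_derivation X Hbr Hideal.
apply: iff_trans (closed_iff_block S dimW H hder).
exact: (closed_phi_iff Hdimu HXu HX1 HSU3 Hbr Hideal).
Qed.
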